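(* Let $U_\alpha(\mathfrak{g})$ be the quantum (1+1) centrally extended Poincaré algebra generated by $M,P_0,P_1,K$ with coproducts $$\begin{aligned} \Delta(M)&=M\otimes1+e^{-\alpha P_1}\otimes M+(e^{-\alpha P_1}-1)\otimes P_0,\quad &\Delta(P_0)&=P_0\otimes1+1\otimes P_0,\\ \Delta(P_1)&=P_1\otimes1+1\otimes P_1,\quad &\Delta(K)&=K\otimes e^{\alpha P_1}+1\otimes K, \end{aligned}$$ and commutation relations $$\begin{gathered} [P_0,P_1]=[M,P_0]=[M,P_1]=0,\quad [K,P_0]=\frac{e^{\alpha P_1}-1}{\alpha},\quad [K,P_1]=(M+P_0)e^{\alpha P_1},\\ [K,M]=-\left(\frac{\cosh(\alpha P_1)-1}{\alpha}+\frac{\alpha}{2}(M+P_0)^2e^{\alpha P_1}\right). \end{gathered}$$ Let $x_{abcd}$ be the basis dual to the ordered basis $M^aP_0^bP_1^cK^d$, and let $\theta=x_{1000}$, $a_0=x_{0100}$, $a_1=x_{0010}$, $\chi=x_{0001}$. Then in the dual Hopf algebra (the quantum (1+1) centrally extended Poincaré group) the local coordinates have coproducts $$\begin{aligned} \Delta(\theta)&=\theta\otimes1+1\otimes\theta+(\cosh\chi-1)\otimes a_0+\sinh\chi\otimes a_1,\\ \Delta(a_0)&=a_0\otimes1+\cosh\chi\otimes a_0+\sinh\chi\otimes a_1,\\ \Delta(a_1)&=a_1\otimes1+\cosh\chi\otimes a_1+\sinh\chi\otimes a_0,\\ \Delta(\chi)&=\chi\otimes1+1\otimes\chi, \end{aligned}$$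 and satisfy the compatible commutation relations $$\begin{gathered} [a_0,a_1]=\alpha\theta,\quad[\theta,a_0]=0,\quad[\theta,a_1]=\alpha\theta,\\ [\chi,\theta]=\alpha(\cosh\chi-1),\quad[\chi,a_0]=\alpha(\cosh\chi-1),\quad[\chi,a_1]=\alpha\sinh\chi . \end{gathered}$$
   Context: Everything is formal in $\alpha$: $H=U_\alpha(\mathfrak{g})$ is a topologically free $\mathbb{R}[[\alpha]]$-module with topological basis $X^{abcd}=M^aP_0^bP_1^cK^d$, $a,b,c,d\in\mathbb{Z}_{\ge0}$. $H^*$ is the dual (topological) Hopf algebra, whose elements are (possibly infinite) combinations of the dual basis elements defined by $\langle x_{abcd},X^{ijkl}\rangle=\delta_a^i\delta_b^j\delta_c^k\delta_d^l$. The product of $H^*$ is dual to the coproduct of $H$: $\langle xy,X\rangle=\langle x\otimes y,\Delta(X)\rangle$; the coproduct of $H^*$ is dual to the product of $H$: $\langle\Delta(x),X\otimes Y\rangle=\langle x,XY\rangle$. $\cosh\chi$ and $\sinh\chi$ are the usual power series in $\chi\in H^*$. ''Compatible'' means that $\Delta$ is an algebra homomorphism. *)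

(* Defs.v *)
From HB Require Import structures.
From mathcomp Require Import all_boot all_order all_algebra.
From mathcomp Require Import finmap.
From mathcomp Require Import monalg.
From mathcomp Require Import boolp reals.

Set Implicit Arguments.
Unset Strict Implicit.
Unset Printing Implicit Defensive.

Import GRing.Theory.
Local Open Scope ring_scope.

Definition fps (V : Type) := nat -> V.

HB.instance Definition _ (V : Type) := gen_eqMixin (fps V).
HB.instance Definition _ (V : Type) := gen_choiceMixin (fps V).

Section FpsZmod.
Variable V : zmodType.

Definition fps_zero : fps V := fun=> 0.
Definition fps_opp (x : fps V) : fps V := fun n => - x n.
Definition fps_add (x y : fps V) : fps V := fun n => x n + y n.

Fact fps_addA : associative fps_add.
Proof. by move=> x y z; apply/funext=> n; rewrite /fps_add addrA. Qed.
Fact fps_addC : commutative fps_add.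
Proof. by move=> x y; apply/funext=> n; rewrite /fps_add addrC. Qed.
Fact fps_add0 : left_id fps_zero fps_add.
Proof. by move=> x; apply/funext=> n; rewrite /fps_add add0r. Qed.
Fact fps_addN : left_inverse fps_zero fps_opp fps_add.
Proof. by move=> x; apply/funext=> n; rewrite /fps_add addNr. Qed.

HB.instance Definition _ :=
  GRing.isZmodule.Build (fps V) fps_addA fps_addC fps_add0 fps_addN.

Lemma fpsDE (x y : fps V) n : (x + y) n = x n + y n. Proof. by []. Qed.
Lemma fpsNE (x : fps V) n : (- x) n = - x n. Proof. by []. Qed.
Lemma fps0E n : (0 : fps V) n = 0. Proof. by []. Qed.

Lemma sum_triangle (F : nat -> nat -> nat -> V) n :
  \sum_(i < n.+1) \sum_(j < i.+1) F j (i - j)%N (n - i)%N =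
  \sum_(j < n.+1) \sum_(k < (n - j).+1) F j k (n - j - k)%N.
Proof.
transitivity (\sum_(i < n.+1) \sum_(j < n.+1 | (j <= i)%N)
                F j (i - j)%N (n - i)%N).
  apply: eq_bigr => i _.
  rewrite -(big_mkord xpredT (fun j => F j (i - j)%N (n - i)%N)).
  rewrite (big_nat_widen _ _ n.+1) //= big_mkord.
  by apply: eq_bigl.
rewrite (exchange_big_dep xpredT) //=; apply: eq_bigr => j _.
rewrite -(big_mkord (fun i => (j <= i)%N) (fun i => F j (i - j)%N (n - i)%N)).
rewrite -(big_mkord xpredT (fun k => F j k (n - j - k)%N)).
transitivity (\sum_(j <= i < n.+1) F j (i - j)%N (n - i)%N).
  by rewrite [RHS](big_nat_widenl _ 0).
rewrite -{1}[nat_of_ord j]add0n big_addn subSn; last by rewrite -ltnS.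
by apply: eq_bigr => k _; rewrite addnK addnC subnDA.
Qed.

End FpsZmod.

Section FpsRing.
Variable R : comNzRingType.

Definition fpsC (c : R) : fps R := fun n => if n is 0 then c else 0.
Definition fps_mul (c d : fps R) : fps R :=
  fun n => \sum_(i < n.+1) c i * d (n - i)%N.

Fact fps_mulA : associative fps_mul.
Proof.
move=> x y z; apply/funext=> n; rewrite /fps_mul.
transitivity (\sum_(j < n.+1) \sum_(k < (n - j).+1)
                x j * (y k * z (n - j - k)%N)).
  by apply: eq_bigr => j _; rewrite mulr_sumr.
rewrite -(sum_triangle (fun a b c => x a * (y b * z c))).
by apply: eq_bigr => i _; rewrite mulr_suml; apply: eq_bigr => j _; rewrite mulrA.
Qed.
Fact fps_mulC : commutative fps_mul.
Proof.
move=> x y; apply/funext=> n; rewrite /fps_mul (reindex_inj rev_ord_inj) /=.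
apply: eq_bigr => i _; rewrite subSS subKn 1?mulrC //.
by rewrite -ltnS.
Qed.
Fact fps_mul1 : left_id (fpsC 1) fps_mul.
Proof.
move=> x; apply/funext=> n; rewrite /fps_mul big_ord_recl /= mul1r subn0.
by rewrite big1 ?addr0 // => i _; rewrite mul0r.
Qed.
Fact fps_mulDl : left_distributive fps_mul +%R.
Proof.
move=> x y z; apply/funext=> n; rewrite fpsDE /fps_mul -big_split.
by apply: eq_bigr => i _; rewrite fpsDE mulrDl.
Qed.
Fact fps_1neq0 : fpsC 1 != 0.
Proof. by apply/eqP => /(congr1 (fun f => f 0%N))/eqP; rewrite oner_eq0. Qed.

HB.instance Definition _ := GRing.Zmodule_isComNzRing.Build (fps R)
  fps_mulA fps_mulC fps_mul1 fps_mulDl fps_1neq0.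

Definition alpha : fps R := fun n => (n == 1%N)%:R.

Lemma fpsME (c d : fps R) n : (c * d) n = \sum_(i < n.+1) c i * d (n - i)%N.
Proof. by []. Qed.

End FpsRing.

Section FpsLmod.
Variables (R : comNzRingType) (V : lmodType R).

Definition fps_scale (c : fps R) (x : fps V) : fps V :=
  fun n => \sum_(i < n.+1) c i *: x (n - i)%N.

Fact fps_scaleA c d x : fps_scale c (fps_scale d x) = fps_scale (c * d) x.
Proof.
apply/funext=> n; rewrite /fps_scale.
transitivity (\sum_(j < n.+1) \sum_(k < (n - j).+1)
                c j *: (d k *: x (n - j - k)%N)).
  by apply: eq_bigr => j _; rewrite scaler_sumr.
rewrite -(sum_triangle (fun a b e => c a *: (d b *: x e))).
apply: eq_bigr => i _; rewrite fpsME scaler_suml.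
by apply: eq_bigr => j _; rewrite scalerA.
Qed.
Fact fps_scale1 : left_id 1 fps_scale.
Proof.
move=> x; apply/funext=> n; rewrite /fps_scale big_ord_recl /= scale1r subn0.
by rewrite big1 ?addr0 // => i _; rewrite scale0r.
Qed.
Fact fps_scaleDr : right_distributive fps_scale +%R.
Proof.
move=> c x y; apply/funext=> n; rewrite fpsDE /fps_scale -big_split.
by apply: eq_bigr => i _; rewrite fpsDE scalerDr.
Qed.
Fact fps_scaleDl x : {morph fps_scale^~ x : c d / c + d}.
Proof.
move=> c d; apply/funext=> n; rewrite fpsDE /fps_scale -big_split.
by apply: eq_bigr => i _; rewrite fpsDE scalerDl.
Qed.

HB.instance Definition _ := GRing.Zmodule_isLmodule.Build (fps R) (fps V)
  fps_scaleA fps_scale1 fps_scaleDr fps_scaleDl.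

Lemma fpsZE (c : fps R) (x : fps V) n :
  (c *: x) n = \sum_(i < n.+1) c i *: x (n - i)%N.
Proof. by []. Qed.

(* Division by alpha: the inverse of [x |-> alpha *: x] on the series without
   constant term (a nonzero constant term is dropped). *)
Definition divalpha (x : fps V) : fps V := fun n => x n.+1.

Lemma alphaZE (x : fps V) n : (alpha R *: x) n = if n is m.+1 then x m else 0.
Proof.
rewrite fpsZE; case: n => [|m]; first by rewrite big_ord1 scale0r.
rewrite big_ord_recl scale0r add0r big_ord_recl scale1r subSS subn0.
by rewrite big1 ?addr0 // => i _; rewrite scale0r.
Qed.

Lemma divalphaK (x : fps V) : x 0%N = 0 -> alpha R *: divalpha x = x.
Proof. by move=> x0; apply/funext=> -[|n]; rewrite alphaZE. Qed.

Definition fps_const (v : V) : fps V := fun n => if n is 0 then v else 0.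

Lemma fps_decomp (x : fps V) :
  x = fps_const (x 0%N) + alpha R *: divalpha x.
Proof.
by apply/funext=> -[|n]; rewrite fpsDE alphaZE ?addr0 ?add0r.
Qed.

Lemma fpsCZE c (x : fps V) n : (fpsC c *: x) n = c *: x n.
Proof.
rewrite fpsZE big_ord_recl subn0 big1 ?addr0 // => i _.
by rewrite scale0r.
Qed.

End FpsLmod.

(* [tfree R I] is V[[alpha]] for the vector space V with basis I, that is the
   topologically free R[[alpha]]-module with topological basis I: its elements
   are the convergent sums of [c_i *: e_i] where, for every N, all but finitely
   many c_i in R[[alpha]] are divisible by alpha^N.  The completed tensor
   product of [tfree R I] and [tfree R J] is [tfree R (I * J)]. *)
Definition tfree (R : comNzRingType) (I : choiceType) := fps {malg R[I]}.

HB.instance Definition _ (R : comNzRingType) (I : choiceType) :=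
  GRing.Lmodule.on (tfree R I).

Definition ebasis (R : comNzRingType) (I : choiceType) (i : I) : tfree R I :=
  fps_const << i >>.

Section Lin.
Variables (R : comNzRingType) (I : choiceType) (W : lmodType R).

Definition vlin (g : I -> W) (v : {malg R[I]}) : W :=
  \sum_(i <- msupp v) v@_i *: g i.

(* The alpha-adically convergent sum of the [x_i *: phi i], where the x_i in
   R[[alpha]] are the coordinates of [x]; equivalently the unique
   R[[alpha]]-linear map with value [phi i] at [ebasis i]. *)
Definition lin (phi : I -> fps W) (x : tfree R I) : fps W :=
  fun n => \sum_(p < n.+1) vlin (fun i => phi i (n - p)%N) (x p).

Lemma vlinw (g : I -> W) (v : {malg R[I]}) (d : {fset I}) :
  (msupp v `<=` d)%fset -> vlin g v = \sum_(i <- d) v@_i *: g i.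
Proof.
move=> sd; apply: big_fset_incl => // i _ niv.
by rewrite mcoeff_outdom // scale0r.
Qed.

Lemma vlinD g v w : vlin g (v + w) = vlin g v + vlin g w.
Proof.
rewrite (vlinw _ (msuppD_le v w)) (vlinw _ (fsubsetUl (msupp v) (msupp w))).
rewrite (vlinw _ (fsubsetUr (msupp v) (msupp w))) -big_split.
by apply: eq_bigr => i _; rewrite mcoeffD scalerDl.
Qed.

Lemma mcoeffZ' (c : R) (v : {malg R[I]}) i : (c *: v)@_i = c * v@_i.
Proof. exact: fgscaleE. Qed.

Lemma vlinZ g c v : vlin g (c *: v) = c *: vlin g v.
Proof.
have sd : (msupp (c *: v) `<=` msupp v)%fset.
  apply/fsubsetP => i; rewrite -!mcoeff_neq0 mcoeffZ'.
  by apply: contra_neq => ->; rewrite mulr0.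
rewrite (vlinw _ sd) scaler_sumr.
by apply: eq_bigr => i _; rewrite mcoeffZ' scalerA.
Qed.

Lemma vlin0 g : vlin g 0 = 0.
Proof. by rewrite /vlin msupp0 big_seq_fset0. Qed.

Lemma vlinU g i : vlin g << i >> = g i.
Proof. by rewrite (vlinw _ msuppU_le) big_seq_fset1 mcoeffUU scale1r. Qed.

Lemma vlin_sum g n (F : 'I_n -> {malg R[I]}) :
  vlin g (\sum_(i < n) F i) = \sum_(i < n) vlin g (F i).
Proof. exact: (big_morph _ (vlinD g) (vlin0 g)). Qed.

Lemma lin_is_linear phi : linear (lin phi).
Proof.
move=> c x y; apply/funext=> n; rewrite fpsDE fpsZE /lin.
transitivity (\sum_(p < n.+1) \sum_(i < p.+1)
    (c i *: vlin (fun k => phi k (n - p)%N) (x (p - i)%N)) +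
    \sum_(p < n.+1) vlin (fun k => phi k (n - p)%N) (y p)).
  rewrite -big_split; apply: eq_bigr => p _.
  rewrite fpsDE vlinD fpsZE vlin_sum; congr (_ + _).
  by apply: eq_bigr => i _; rewrite vlinZ.
congr (_ + _).
rewrite (sum_triangle (fun a b d => c a *: vlin (fun k => phi k d) (x b))).
by apply: eq_bigr => i _; rewrite scaler_sumr.
Qed.

HB.instance Definition _ phi := GRing.isLinear.Build (fps R) (tfree R I)
  (fps W) _ (lin phi) (lin_is_linear phi).

Lemma lin_basis phi i : lin phi (ebasis R i) = phi i.
Proof.
apply/funext=> n; rewrite /lin big_ord_recl /= vlinU subn0.
by rewrite big1 ?addr0 // => p _; rewrite vlin0.
Qed.

(* Linear maps are automatically continuous. *)
Lemma lin_ext (f g : {linear tfree R I -> fps W}) :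
  (forall i, f (ebasis R i) = g (ebasis R i)) -> f =1 g.
Proof.
move=> fg.
have cE v : fps_const v = \sum_(i <- msupp v) fpsC v@_i *: ebasis R i :> tfree R I.
  have constD : {morph (@fps_const R {malg R[I]}) : a b / a + b >-> (a + b : tfree R I)}.
    by move=> a b; apply/funext=> -[|n]; rewrite fpsDE ?addr0.
  have const0 : fps_const 0 = 0 :> tfree R I by apply/funext=> -[|n].
  rewrite {1}[v]monalgE (big_morph _ constD const0).
  apply: eq_bigr => i _; apply/funext=> n; rewrite fpsCZE.
  case: n => [|n] /=; last by rewrite scaler0.
  by apply/malgP => k; rewrite mcoeffZ' !mcoeffU mulr_natr.
have fgc v : f (fps_const v) = g (fps_const v).
  by rewrite cE !linear_sum; apply: eq_bigr => i _; rewrite !linearZ /= fg.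
move=> x; apply/funext=> n; elim: n x => [|n IH] x.
  by rewrite (fps_decomp x) !linearD !linearZ /= fgc !fpsDE !alphaZE.
by rewrite (fps_decomp x) !linearD !linearZ /= fgc !fpsDE !alphaZE IH.
Qed.

Lemma linE (f : {linear tfree R I -> fps W}) x :
  f x = lin (fun i => f (ebasis R i)) x.
Proof.
by apply: (lin_ext (g := lin (fun i => f (ebasis R i)))) => i /=; rewrite lin_basis.
Qed.

End Lin.

Lemma lin_comp (R : comNzRingType) (I J : choiceType) (W : lmodType R)
    (f : {linear tfree R J -> fps W}) (phi : I -> tfree R J) (x : tfree R I) :
  f (lin phi x) = lin (fun i => f (phi i)) x.
Proof.
rewrite -[LHS]/((f \o lin phi) x) linE.
by congr (lin _ x); apply/funext=> i; rewrite /= lin_basis.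
Qed.

Section Tensor.
Variables (R : comNzRingType) (I J : choiceType).

Definition tens (x : tfree R I) (y : tfree R J) : tfree R (I * J)%type :=
  lin (fun i => lin (fun j => ebasis R (i, j)) y) x.

Lemma tens_basis i j : tens (ebasis R i) (ebasis R j) = ebasis R (i, j).
Proof. by rewrite /tens !lin_basis. Qed.

End Tensor.

Notation "x ⊗ y" := (tens x y) (at level 40, left associativity) : ring_scope.

Definition tassoc (R : comNzRingType) (I J L : choiceType) :
    tfree R ((I * J) * L)%type -> tfree R (I * (J * L))%type :=
  lin (fun p => ebasis R (p.1.1, (p.1.2, p.2))).

(* R[[alpha]]-bilinearity forces continuity of the product. *)
Record talgebra (R : comNzRingType) (I : choiceType) := TAlgebra {
  tone : tfree R I;
  tmul : tfree R I -> tfree R I -> tfree R I;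
  tmulA : associative tmul;
  tmul1l : left_id tone tmul;
  tmul1r : right_id tone tmul;
  tmul_linearl : forall y, linear (tmul^~ y);
  tmul_linearr : forall x, linear (tmul x) }.

Definition tsort R I (A : @talgebra R I) : Type := tfree R I.
Coercion tsort : talgebra >-> Sortclass.

Section TAlgebraRing.
Variables (R : comNzRingType) (I : choiceType) (A : talgebra R I).

HB.instance Definition _ := GRing.Lmodule.copy (tsort A) (tfree R I).

Fact tmulDl : left_distributive (tmul A) +%R.
Proof.
by move=> x y z; have := tmul_linearl A z 1 x y; rewrite !scale1r.
Qed.
Fact tmulDr : right_distributive (tmul A) +%R.
Proof.
by move=> x y z; have := tmul_linearr A x 1 y z; rewrite !scale1r.
Qed.

HB.instance Definition _ := GRing.Zmodule_isPzRing.Build (tsort A)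
  (tmulA A) (tmul1l A) (tmul1r A) tmulDl tmulDr.

Definition basis (i : I) : A := ebasis R i.

(* Product of the completed tensor product A ⊗ A:
   (a ⊗ b)(c ⊗ d) = ac ⊗ bd, extended linearly and continuously. *)
Definition tens_mul (x y : tfree R (I * I)%type) : tfree R (I * I)%type :=
  lin (fun p => lin (fun q =>
    (basis p.1 * basis q.1) ⊗ (basis p.2 * basis q.2)) y) x.

End TAlgebraRing.

Section Hopf.
Variables (R : comNzRingType) (I : choiceType).

Record thopf := THopf {
  thopf_alg :> talgebra R I;
  coprod : {linear thopf_alg -> tfree R (I * I)%type};
  counit : {linear thopf_alg -> fps R^o};
  antipode : {linear thopf_alg -> thopf_alg};
  coprod1 : coprod 1 = (1 : thopf_alg) ⊗ (1 : thopf_alg);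
  coprodM : forall x y, coprod (x * y) = tens_mul thopf_alg (coprod x) (coprod y);
  counit1 : counit 1 = 1 :> fps R;
  counitM : forall x y, counit (x * y) = (counit x : fps R) * counit y :> fps R;
  coprodA : forall x,
    tassoc (lin (fun p => coprod (basis thopf_alg p.1) ⊗ basis thopf_alg p.2) (coprod x)) =
    lin (fun p => basis thopf_alg p.1 ⊗ coprod (basis thopf_alg p.2)) (coprod x);
  counitl : forall x,
    lin (fun p => (counit (basis thopf_alg p.1) : fps R) *: basis thopf_alg p.2) (coprod x) = x;
  counitr : forall x,
    lin (fun p => (counit (basis thopf_alg p.2) : fps R) *: basis thopf_alg p.1) (coprod x) = x;
  antipodel : forall x,
    lin (fun p => antipode (basis thopf_alg p.1) * basis thopf_alg p.2) (coprod x) =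
    (counit x : fps R) *: (1 : thopf_alg);
  antipoder : forall x,
    lin (fun p => basis thopf_alg p.1 * antipode (basis thopf_alg p.2)) (coprod x) =
    (counit x : fps R) *: (1 : thopf_alg) }.

End Hopf.

Lemma fps_scaleo (R : comNzRingType) (c : fps R) (x : fps R^o) :
  c *: x = c * x :> fps R.
Proof. by []. Qed.

Section Dual.
Variables (R : comNzRingType) (I : choiceType).

(* The linear (hence continuous) functional on [tfree R I] with value [x i] at
   the basis vector i, i.e. the possibly infinite combination of the dual basis
   vectors with coefficients [x i]. *)
Definition ldual := I -> fps R.

HB.instance Definition _ := gen_eqMixin ldual.
HB.instance Definition _ := gen_choiceMixin ldual.

Definition ldual_zero : ldual := fun=> 0.
Definition ldual_opp (x : ldual) : ldual := fun i => - x i.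
Definition ldual_add (x y : ldual) : ldual := fun i => x i + y i.
Definition ldual_scale (c : fps R) (x : ldual) : ldual := fun i => c * x i.

Fact ldual_addA : associative ldual_add.
Proof. by move=> x y z; apply/funext=> i; rewrite /ldual_add addrA. Qed.
Fact ldual_addC : commutative ldual_add.
Proof. by move=> x y; apply/funext=> i; rewrite /ldual_add addrC. Qed.
Fact ldual_add0 : left_id ldual_zero ldual_add.
Proof. by move=> x; apply/funext=> i; rewrite /ldual_add add0r. Qed.
Fact ldual_addN : left_inverse ldual_zero ldual_opp ldual_add.
Proof. by move=> x; apply/funext=> i; rewrite /ldual_add addNr. Qed.

HB.instance Definition _ :=
  GRing.isZmodule.Build ldual ldual_addA ldual_addC ldual_add0 ldual_addN.

Fact ldual_scaleA c d x :
  ldual_scale c (ldual_scale d x) = ldual_scale (c * d) x.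
Proof. by apply/funext=> i; rewrite /ldual_scale mulrA. Qed.
Fact ldual_scale1 : left_id 1 ldual_scale.
Proof. by move=> x; apply/funext=> i; rewrite /ldual_scale mul1r. Qed.
Fact ldual_scaleDr : right_distributive ldual_scale +%R.
Proof. by move=> c x y; apply/funext=> i; rewrite /ldual_scale mulrDr. Qed.
Fact ldual_scaleDl x : {morph ldual_scale^~ x : c d / c + d}.
Proof. by move=> c d; apply/funext=> i; rewrite /ldual_scale mulrDl. Qed.

HB.instance Definition _ := GRing.Zmodule_isLmodule.Build (fps R) ldual
  ldual_scaleA ldual_scale1 ldual_scaleDr ldual_scaleDl.

Definition pairing (x : ldual) (X : tfree R I) : fps R := lin (W := R^o) x X.

Definition dbasis (i : I) : ldual := fun j => (i == j)%:R.

Lemma pairing_basis x i : pairing x (ebasis R i) = x i.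
Proof. exact: (@lin_basis R I R^o x i). Qed.

Lemma pairing_dbasis i j : pairing (dbasis i) (ebasis R j) = (i == j)%:R.
Proof. exact: pairing_basis. Qed.

Lemma pairingDl x y X : pairing (x + y) X = pairing x X + pairing y X.
Proof.
apply/funext=> n; rewrite fpsDE /pairing /lin -big_split /=.
apply: eq_bigr => p _; rewrite /vlin -big_split /=.
by apply: eq_bigr => i _; rewrite scalerDr.
Qed.

Lemma pairingZl c x X : pairing (c *: x) X = c * pairing x X.
Proof.
have := @lin_ext R I R^o (lin (W := R^o) (c *: x)) (c \*: lin (W := R^o) x).
by apply=> i /=; rewrite !lin_basis.
Qed.

(* Convergence of the series of general term [u k] towards [s], for the
   topology of pointwise alpha-adic convergence. *)
Definition dseries_cvg (u : nat -> ldual) (s : ldual) := forall X n,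
  exists N0, forall N, (N0 <= N)%N ->
    pairing (\sum_(k < N) u k) X n = pairing s X n.

Lemma dseries_cvg_unique u s t : dseries_cvg u s -> dseries_cvg u t -> s = t.
Proof.
move=> us ut; apply/funext=> i; apply/funext=> n.
have [N1 H1] := us (ebasis R i) n; have [N2 H2] := ut (ebasis R i) n.
rewrite -!(pairing_basis _ i) -(H1 (maxn N1 N2)) ?leq_maxl //.
by rewrite (H2 (maxn N1 N2)) ?leq_maxr.
Qed.

End Dual.

Definition dtens (R : comNzRingType) (I J : choiceType)
    (x : ldual R I) (y : ldual R J) : ldual R (I * J)%type :=
  fun p => x p.1 * y p.2.

Notation "x ⊗^* y" := (dtens x y) (at level 40, left associativity) : ring_scope.

Lemma dtensE (R : comNzRingType) (I J : choiceType) (x : ldual R I)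
    (y : ldual R J) X Y :
  pairing (x ⊗^* y) (X ⊗ Y) = pairing x X * pairing y Y.
Proof.
rewrite /pairing /tens lin_comp mulrC.
have := @lin_ext R I R^o
  (lin (W := R^o) (fun i => lin (W := R^o) (x ⊗^* y) (lin (fun j => ebasis R (i, j)) Y)))
  (pairing y Y \*: lin (W := R^o) x).
apply=> i /=; rewrite !lin_basis lin_comp.
have := @lin_ext R J R^o
  (lin (W := R^o) (fun j => lin (W := R^o) (x ⊗^* y) (ebasis R (i, j))))
  (x i \*: lin (W := R^o) y).
move=> -> => [|j /=]; last by rewrite !lin_basis.
by rewrite /= !fps_scaleo [RHS]mulrC.
Qed.

Definition hdual (R : comNzRingType) (I : choiceType) (U : thopf R I) :=
  ldual R I.

Section DualHopf.
Variables (R : comNzRingType) (I : choiceType) (U : thopf R I).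

Local Notation hdual := (hdual U).

HB.instance Definition _ := GRing.Lmodule.copy hdual (ldual R I).

Definition dual_one : hdual := fun i => counit U (basis U i).
Definition dual_mul (x y : hdual) : hdual :=
  fun i => pairing (x ⊗^* y) (coprod U (basis U i)).

Lemma dual_mulE (x y : hdual) (X : U) :
  pairing (dual_mul x y) X = pairing (x ⊗^* y) (coprod U X).
Proof.
have := @lin_ext R I R^o (lin (W := R^o) (dual_mul x y))
  (lin (W := R^o) (x ⊗^* y) \o coprod U).
by apply=> i /=; rewrite !lin_basis.
Qed.

Lemma lin_mulr (J : choiceType) (g : J -> fps R^o) (c : fps R) (X : tfree R J) :
  (lin g X : fps R) * c = lin (fun i => (g i : fps R) * c : fps R^o) X :> fps R.
Proof.
rewrite mulrC; have := @lin_ext R J R^o (c \*: lin g)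
  (lin (fun i => (g i : fps R) * c : fps R^o)).
by apply=> i /=; rewrite !lin_basis fps_scaleo mulrC.
Qed.

Fact dual_mulA : associative dual_mul.
Proof.
move=> x y z; apply/funext=> i.
pose T : ldual R (I * (I * I))%type := fun t => x t.1 * (y t.2.1 * z t.2.2).
have := congr1 (pairing T) (coprodA (basis U i)).
rewrite /pairing /tassoc !lin_comp => E.
transitivity (lin (W := R^o) (fun p : I * I =>
    lin (W := R^o) T (basis U p.1 ⊗ coprod U (basis U p.2))) (coprod U (basis U i))).
  rewrite [LHS]/(lin (W := R^o) (x ⊗^* dual_mul y z) _).
  congr (lin (W := R^o) _ _); apply/funext=> p.
  rewrite /tens lin_basis lin_comp /dtens /dual_mul /pairing mulrC lin_mulr.
  by congr (lin (W := R^o) _ _); apply/funext=> q; rewrite /= lin_basis /T /= mulrC mulrA.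
rewrite -{}E; congr (lin (W := R^o) _ _); apply/funext=> p.
rewrite {1}/tens lin_comp /= /dtens /dual_mul /pairing lin_mulr.
congr (lin (W := R^o) _ _); apply/funext=> q.
by rewrite lin_basis lin_basis lin_basis /T /= mulrA.
Qed.

Fact dual_mul1 : left_id dual_one dual_mul.
Proof.
move=> x; apply/funext=> i; rewrite -[RHS](pairing_basis x).
rewrite -[X in pairing x X](counitl (basis U i)) /pairing lin_comp.
by congr (lin (W := R^o) _ _); apply/funext=> p; rewrite linearZ /= lin_basis fps_scaleo.
Qed.

Fact dual_1mul : right_id dual_one dual_mul.
Proof.
move=> x; apply/funext=> i; rewrite -[RHS](pairing_basis x).
rewrite -[X in pairing x X](counitr (basis U i)) /pairing lin_comp.
by congr (lin (W := R^o) _ _); apply/funext=> p; rewrite linearZ /= lin_basis fps_scaleo /dtens mulrC.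
Qed.

Fact dual_mulDl : left_distributive dual_mul +%R.
Proof.
move=> x y z; apply/funext=> i; rewrite -[RHS]pairingDl.
by congr (pairing _ _); apply/funext=> p; exact: mulrDl.
Qed.

Fact dual_mulDr : right_distributive dual_mul +%R.
Proof.
move=> x y z; apply/funext=> i; rewrite -[RHS]pairingDl.
by congr (pairing _ _); apply/funext=> p; exact: mulrDr.
Qed.

HB.instance Definition _ := GRing.Zmodule_isPzRing.Build hdual
  dual_mulA dual_mul1 dual_1mul dual_mulDl dual_mulDr.

(* The functional X ⊗ Y |-> <x, X Y>, in the dual of the completed tensor
   product, which is the completed tensor product of the duals. *)
Definition dual_coprod (x : hdual) : ldual R (I * I)%type :=
  fun p => pairing x (basis U p.1 * basis U p.2).

Lemma dual_coprodE (x : hdual) (X Y : U) :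
  pairing (dual_coprod x) ((X : tfree R I) ⊗ (Y : tfree R I)) =
  pairing x (X * Y).
Proof.
have L (Z : U) : linear (fun V : U => Z * V) by exact: tmul_linearr.
have L' (Z : U) : linear (fun V : U => V * Z) by exact: tmul_linearl.
pose l Z := HB.pack_for {linear tfree R I -> tfree R I}
  (fun V : U => Z * V) (GRing.isLinear.Build _ _ _ _ _ (L Z)).
pose l' Z := HB.pack_for {linear tfree R I -> tfree R I}
  (fun V : U => V * Z) (GRing.isLinear.Build _ _ _ _ _ (L' Z)).
rewrite /pairing /tens lin_comp.
have := @lin_ext R I R^o
  (lin (W := R^o) (fun i => lin (W := R^o) (dual_coprod x)
     (lin (fun j => ebasis R (i, j)) Y)))
  (lin (W := R^o) x \o l' Y).
apply=> i /=; rewrite lin_basis lin_comp.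
have := @lin_ext R I R^o
  (lin (W := R^o) (fun j => lin (W := R^o) (dual_coprod x) (ebasis R (i, j))))
  (lin (W := R^o) x \o l (basis U i)).
by apply=> j /=; rewrite !lin_basis.
Qed.

(* Product of the dual of U ⊗ U, that is
   <F G, X ⊗ Y> = <F ⊗ G, (id ⊗ flip ⊗ id) (Delta X ⊗ Delta Y)>;
   the outer pairing is over Delta X and the inner one over Delta Y. *)
Definition dual_tens_mul (F G : ldual R (I * I)%type) : ldual R (I * I)%type :=
  fun p => pairing (fun k => pairing (fun l => F (k.1, l.1) * G (k.2, l.2))
    (coprod U (basis U p.2))) (coprod U (basis U p.1)).

Lemma dual_tens_mulE (x y x' y' : hdual) :
  dual_tens_mul (x ⊗^* y) (x' ⊗^* y') = (x * x') ⊗^* (y * y').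
Proof.
apply/funext=> p.
transitivity ((lin (W := R^o) (x ⊗^* x') (coprod U (basis U p.1)) : fps R) *
  (lin (W := R^o) (y ⊗^* y') (coprod U (basis U p.2)) : fps R)); last by [].
rewrite lin_mulr; congr (lin (W := R^o) _ _); apply/funext=> k.
rewrite mulrC lin_mulr; congr (lin (W := R^o) _ _); apply/funext=> l.
by rewrite /dtens /= mulrACA mulrC mulrACA mulrC.
Qed.

End DualHopf.

Section Series.
Variable R : fieldType.

Definition exp_coef (n : nat) : R := n`!%:R^-1.
Definition cosh_coef (n : nat) : R := if odd n then 0 else n`!%:R^-1.
Definition sinh_coef (n : nat) : R := if odd n then n`!%:R^-1 else 0.

Variables (I : choiceType) (A : talgebra R I).

(* f(alpha x), the alpha-adically convergent sum of the f_n alpha^n x^n. *)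
Definition alpha_eval (f : nat -> R) (x : A) : A :=
  (fun m => \sum_(n < m.+1) f n *: (x ^+ n : tfree R I) (m - n)%N) : tfree R I.

Lemma alphaXZE (V : lmodType R) n (x : fps V) m :
  (alpha R ^+ n *: x) m = if (n <= m)%N then x (m - n)%N else 0.
Proof.
elim: n m => [|n IH] m; first by rewrite expr0 scale1r subn0.
by rewrite exprS -scalerA alphaZE; case: m => [|m] //; rewrite IH ltnS subSS.
Qed.

Lemma alpha_evalE f (x : A) N m : (m < N)%N ->
  (alpha_eval f x : tfree R I) m =
  (\sum_(n < N) (fpsC (f n) * alpha R ^+ n) *: (x ^+ n : tfree R I)) m.
Proof.
move=> mN; have sumE (F : 'I_N -> tfree R I) : (\sum_n F n) m = \sum_n F n m.
  by apply: (big_morph (fun y : tfree R I => y m)).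
rewrite sumE /alpha_eval.
rewrite (big_ord_widen N (fun n => f n *: (x ^+ n : tfree R I) (m - n)%N)) //.
rewrite big_mkcond; apply: eq_bigr => n _.
by rewrite -scalerA fpsCZE alphaXZE ltnS; case: ifP; rewrite // scaler0.
Qed.

End Series.

Definition commutator (A : pzRingType) (x y : A) : A := x * y - y * x.

Notation "⟦ x , y ⟧" := (commutator x y)
  (at level 0, x, y at level 99, format "⟦ x ,  y ⟧") : ring_scope.

Definition pbw : choiceType := (nat * nat * nat * nat)%type.

Record quantum_poincare (R : fieldType) (U : thopf R pbw) (M P0 P1 K : U) :
    Prop := {
  qp_basis : forall a b c d,
    basis U (a, b, c, d) = M ^+ a * P0 ^+ b * P1 ^+ c * K ^+ d;
  qp_coM : coprod U M =
    M ⊗ (1 : U) + alpha_eval (exp_coef R) (- P1) ⊗ M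
    + (alpha_eval (exp_coef R) (- P1) - 1) ⊗ P0;
  qp_coP0 : coprod U P0 = P0 ⊗ (1 : U) + (1 : U) ⊗ P0;
  qp_coP1 : coprod U P1 = P1 ⊗ (1 : U) + (1 : U) ⊗ P1;
  qp_coK : coprod U K = K ⊗ alpha_eval (exp_coef R) P1 + (1 : U) ⊗ K;
  qp_P0P1 : ⟦P0, P1⟧ = 0;
  qp_MP0 : ⟦M, P0⟧ = 0;
  qp_MP1 : ⟦M, P1⟧ = 0;
  qp_KP0 : ⟦K, P0⟧ = divalpha (alpha_eval (exp_coef R) P1 - 1);
  qp_KP1 : ⟦K, P1⟧ = (M + P0) * alpha_eval (exp_coef R) P1;
  qp_KM : ⟦K, M⟧ =
    - ((divalpha (alpha_eval (cosh_coef R) P1 - 1) : U)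
       + (alpha R * fpsC 2^-1) *:
           ((M + P0) ^+ 2 * alpha_eval (exp_coef R) P1)) }.

(* Main.v *)
(* For x in H^* and g in H put <x ◁ g, Y> = <x, g Y>.  This right action turns a
   product into (x y) ◁ g = sum (x ◁ g') (y ◁ g''), with Delta g = sum g' ⊗ g'',
   and M, P_0, P_1 act on H^* by shifting indices.  From K g = g K + [K, g] one
   gets theta ◁ K = a_1, a_0 ◁ K = a_1, a_1 ◁ K = a_0, chi ◁ K = 1, and cosh chi
   and sinh chi are exchanged by K.  A functional is determined by its images
   under M, P_0, P_1 and its values on the K^d.  The difference of the two sides
   of each relation is killed by M, P_0, P_1 and sent by K to a combination of
   such differences, so all relations follow by induction on d; the coproducts
   are obtained in the same way, acting on the first tensor factor. *)
From HB Require Import structures.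
Require Import Defs.
From mathcomp Require Import all_boot all_order all_algebra.
From mathcomp Require Import finmap monalg.
From mathcomp Require Import boolp reals.

Set Implicit Arguments.
Unset Strict Implicit.
Unset Printing Implicit Defensive.

Import GRing.Theory.
Local Open Scope ring_scope.

(** * Alpha-adic continuity of linear maps *)

Section Continuity.
Variable R : comNzRingType.

Lemma alphaZ_inj (V : lmodType R) (x y : fps V) :
  alpha R *: x = alpha R *: y -> x = y.
Proof.
move=> e; apply/funext=> n.
by have := congr1 (fun z : fps V => z n.+1) e; rewrite !alphaZE.
Qed.

(** Splitting off the constant term leaves a multiple of alpha, and [f] commutes with alpha, so each
    induction step lowers the order by one. *)
Lemma linear_trunc (V W : lmodType R) (f : {linear fps V -> fps W}) x y n :
  (forall i, (i <= n)%N -> x i = y i) -> f x n = f y n.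
Proof.
elim: n x y => [|n IH] x y e; rewrite (fps_decomp x) (fps_decomp y) e //.
  by rewrite !linearD !linearZ /= !fpsDE !alphaZE.
by rewrite !linearD !linearZ /= !fpsDE !alphaZE (IH _ (divalpha y)) // => i li; apply: e.
Qed.

Lemma lin_funP (I : choiceType) (W : lmodType R) c (phi psi : I -> fps W) X :
  lin (fun i => c *: phi i + psi i) X = c *: lin phi X + lin psi X.
Proof.
have := @lin_ext R I W (lin (fun i => c *: phi i + psi i)) (c \*: lin phi \+ lin psi).
by apply=> i /=; rewrite !lin_basis.
Qed.

End Continuity.

(** * Multiplication operators and the recursion for series in alpha x *)

Section TranslationMaps.
Variables (R : comNzRingType) (I : choiceType) (A : talgebra R I).

Fact lmul_linear (a : A) : linear (fun z : A => a * z).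
Proof. exact: tmul_linearr. Qed.

(** Typed on the underlying free module, so that [lin_ext] and [linear_trunc] apply to it. *)
Definition lmul (a : A) : {linear tfree R I -> tfree R I} :=
  HB.pack_for {linear tfree R I -> tfree R I} (fun z : A => a * z)
    (GRing.isLinear.Build _ _ _ _ _ (lmul_linear a)).

Fact rmul_linear (a : A) : linear (fun z : A => z * a).
Proof. exact: tmul_linearl. Qed.

Definition rmul (a : A) : {linear tfree R I -> tfree R I} :=
  HB.pack_for {linear tfree R I -> tfree R I} (fun z : A => z * a)
    (GRing.isLinear.Build _ _ _ _ _ (rmul_linear a)).

End TranslationMaps.

(** Each coefficient in alpha only involves a finite partial sum, for which the identity is the
    splitting of the first term. Later computations with exponentials and cosh use this recursion
    only. *)
Lemma alpha_eval_rec (R : fieldType) (I : choiceType) (A : talgebra R I)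
    (f : nat -> R) (x : A) :
  alpha_eval f x =
    fpsC (f 0%N) *: (1 : A) + alpha R *: (x * alpha_eval (fun n => f n.+1) x : A).
Proof.
apply/funext=> m; rewrite (@alpha_evalE _ _ _ _ _ m.+1) //.
rewrite big_ord_recl expr0 mulr1 expr0 !fpsDE; congr (_ + _).
rewrite alphaZE; case: m => [|m]; first by rewrite big_ord0.
(* Continuity of left multiplication by [x] allows the tail series to be replaced by its partial
   sum. *)
rewrite [RHS](@linear_trunc _ _ _ (lmul x) _ (\sum_(n < m.+1)
  (fpsC (f n.+1) * alpha R ^+ n) *: (x ^+ n : tfree R I))); last first.
  by move=> i li; rewrite (@alpha_evalE _ _ _ _ _ m.+1).
rewrite linear_sum; set s := RHS.
transitivity ((alpha R *: (\sum_(n < m.+1)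
   lmul x ((fpsC (f n.+1) * alpha R ^+ n) *: (x ^+ n : tfree R I)))) m.+1).
  rewrite scaler_sumr; apply: (congr1 (fun z : fps {malg R[I]} => z m.+1)).
  apply: eq_bigr => i _.
  rewrite linearZ /= scalerA exprS mulrCA.
  by rewrite [bump 0 i]add1n exprS.
by rewrite alphaZE.
Qed.

(** * The right action of H on its dual *)

Section LeftTranslation.
Variables (R : comNzRingType) (I : choiceType) (U : thopf R I).
Implicit Types (x y : hdual U) (g h : U).

Lemma pairingDr (J : choiceType) (x : ldual R J) X Y :
  pairing x (X + Y) = pairing x X + pairing x Y.
Proof. by rewrite /pairing linearD. Qed.

Lemma pairingZr (J : choiceType) (x : ldual R J) c X :
  pairing x (c *: X) = c * pairing x X.
Proof. by rewrite /pairing linearZ /= fps_scaleo. Qed.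

Definition ltrans x g : hdual U := fun i => pairing x (g * basis U i).

Local Notation "x ◁ g" := (ltrans x g) (at level 39, left associativity).

Lemma ltransE x g (Y : U) : pairing (x ◁ g) Y = pairing x (g * Y).
Proof.
have := @lin_ext R I R^o (lin (W := R^o) (x ◁ g)) (lin (W := R^o) x \o lmul g).
by apply=> i /=; rewrite lin_basis.
Qed.

Lemma ltransM x g h : x ◁ (g * h) = x ◁ g ◁ h.
Proof. by apply/funext=> i; rewrite [RHS]ltransE mulrA. Qed.

Lemma ltrans1 x : x ◁ 1 = x.
Proof. by apply/funext=> i; rewrite /ltrans mul1r pairing_basis. Qed.

Lemma ltransDr x g h : x ◁ (g + h) = x ◁ g + x ◁ h.
Proof. by apply/funext=> i; rewrite /ltrans mulrDl pairingDr. Qed.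

Lemma ltransZr x c g : x ◁ (c *: g) = c *: (x ◁ g).
Proof.
apply/funext=> i; rewrite -[RHS]pairingZr; congr (pairing _ _).
(* Linearity of the product is stated for combinations [c *: g + h]; here h = 0. *)
have E : c *: g + 0 = c *: g :> U by rewrite addr0.
rewrite -E; apply: etrans (tmul_linearl U (basis U i) c g 0) _.
have -> : tmul U 0 (basis U i) = 0 by apply: (mul0r (basis U i)).
by rewrite addr0.
Qed.

Lemma ltransNr x g : x ◁ (- g) = - (x ◁ g).
Proof. by apply/funext=> i; rewrite /ltrans mulNr /pairing linearN. Qed.

Lemma ltransBr x g h : x ◁ (g - h) = x ◁ g - x ◁ h.
Proof. by rewrite ltransDr ltransNr. Qed.

Lemma ltransDl x y g : (x + y) ◁ g = x ◁ g + y ◁ g.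
Proof. by apply/funext=> i; rewrite /ltrans pairingDl. Qed.

Lemma ltransZl c x g : (c *: x) ◁ g = c *: (x ◁ g).
Proof. by apply/funext=> i; rewrite /ltrans pairingZl. Qed.

Lemma ltransNl x g : (- x) ◁ g = - (x ◁ g).
Proof. by rewrite -scaleN1r ltransZl scaleN1r. Qed.

Lemma ltrans0l g : (0 : hdual U) ◁ g = 0.
Proof. by have := ltransZl 0 0 g; rewrite !scale0r. Qed.

Lemma ltransBl x y g : (x - y) ◁ g = x ◁ g - y ◁ g.
Proof. by rewrite ltransDl ltransNl. Qed.

Lemma dual_scaleAl c x y : c *: (x * y) = (c *: x) * y.
Proof.
apply/funext=> i; rewrite -[LHS]pairingZl; congr (pairing _ _).
by apply/funext=> p; rewrite /dtens /= [LHS]mulrA.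
Qed.

Lemma dual_scaleAr c x y : c *: (x * y) = x * (c *: y).
Proof.
apply/funext=> i; rewrite -[LHS]pairingZl; congr (pairing _ _).
by apply/funext=> p; rewrite /dtens /= [LHS]mulrCA.
Qed.

(** The functional sending Y to the pairing of [x ⊗^* y] with T Delta(Y). It is additive in T,
    equals [(x * y) ◁ g] at T = Delta(g) and factors at pure tensors; the product rule follows. *)
Definition mul_ltrans x y (T : tfree R (I * I)%type) : hdual U :=
  fun i => pairing (x ⊗^* y) (tens_mul U T (coprod U (basis U i))).

Lemma ltrans_mul x y g : (x * y) ◁ g = mul_ltrans x y (coprod U g).
Proof. by apply/funext=> i; rewrite /ltrans dual_mulE coprodM. Qed.

Lemma mul_ltransD x y T T' :
  mul_ltrans x y (T + T') = mul_ltrans x y T + mul_ltrans x y T'.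
Proof.
by apply/funext=> i; rewrite /mul_ltrans /tens_mul linearD pairingDr.
Qed.

Lemma pairing_mulr x g h :
  pairing (fun i => pairing x (basis U i * h)) g = pairing x (g * h).
Proof.
have := @lin_ext R I R^o
  (lin (W := R^o) (fun i => pairing x (basis U i * h))) (lin (W := R^o) x \o rmul h).
by apply=> i /=; rewrite lin_basis.
Qed.

Lemma mul_ltrans_tens x y (g h : U) :
  mul_ltrans x y (g ⊗ h) = (x ◁ g) * (y ◁ h).
Proof.
have L : linear (tens_mul U (g ⊗ h)).
  move=> c Z Z'; rewrite /tens_mul -lin_funP.
  by congr (lin _ _); apply/funext=> p; rewrite linearP.
pose l := HB.pack_for {linear tfree R (I * I)%type -> tfree R (I * I)%type}
  (tens_mul U (g ⊗ h)) (GRing.isLinear.Build _ _ _ _ _ L).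
apply/funext=> i.
have := @lin_ext R (I * I)%type R^o (lin (W := R^o) (x ⊗^* y) \o l)
  (lin (W := R^o) ((x ◁ g) ⊗^* (y ◁ h))).
apply=> q /=; rewrite lin_basis /tens_mul lin_comp.
(* For a fixed basis tensor [q] the expression is a product functional, built from right translates
   of [x] and [y], evaluated at [g ⊗ h]; hence it splits. *)
transitivity (pairing ((fun i => pairing x (basis U i * basis U q.1)) ⊗^*
    (fun i => pairing y (basis U i * basis U q.2))) (g ⊗ h)).
  rewrite /pairing; congr (lin (W := R^o) _ _); apply/funext=> p.
  by rewrite lin_basis; apply: dtensE.
by rewrite dtensE !pairing_mulr.
Qed.

Lemma dual1E g : pairing (1 : hdual U) g = counit U g.
Proof.
by have := @lin_ext R I R^o (lin (W := R^o) (1 : hdual U)) (counit U);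
  apply=> i /=; rewrite lin_basis.
Qed.

Lemma ltrans_dual1 g : (1 : hdual U) ◁ g = (counit U g : fps R) *: (1 : hdual U).
Proof.
by apply/funext=> i; rewrite /ltrans dual1E counitM.
Qed.

(** This is [1 * x = x] in the dual, evaluated at [g]. It serves to compute the counit of the
    generators. *)
Lemma counit_suml x g a b c d :
  coprod U g = a ⊗ b + c ⊗ d ->
  (counit U a : fps R) * pairing x b + (counit U c : fps R) * pairing x d
  = pairing x g.
Proof.
move=> E; rewrite -[in RHS](dual_mul1 x) dual_mulE E pairingDr.
by congr (_ + _); rewrite dtensE dual1E.
Qed.

Lemma counit_suml3 x g a b c d e f :
  coprod U g = a ⊗ b + c ⊗ d + e ⊗ f ->
  (counit U a : fps R) * pairing x b + (counit U c : fps R) * pairing x d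
    + (counit U e : fps R) * pairing x f = pairing x g.
Proof.
move=> E; rewrite -[in RHS](dual_mul1 x) dual_mulE E 2!pairingDr.
by congr (_ + _ + _); rewrite dtensE dual1E.
Qed.

Lemma counit_sumr x g a b c d :
  coprod U g = a ⊗ b + c ⊗ d ->
  pairing x a * (counit U b : fps R) + pairing x c * (counit U d : fps R)
  = pairing x g.
Proof.
move=> E; rewrite -[in RHS](dual_1mul x) dual_mulE E pairingDr.
by congr (_ + _); rewrite dtensE dual1E.
Qed.

Lemma ltrans_mul2 x y g a b c d :
  coprod U g = a ⊗ b + c ⊗ d ->
  (x * y) ◁ g = (x ◁ a) * (y ◁ b) + (x ◁ c) * (y ◁ d).
Proof.
move=> E; rewrite ltrans_mul (congr1 (mul_ltrans x y) E) mul_ltransD.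
by congr (_ + _); apply: mul_ltrans_tens.
Qed.

Lemma ltrans_mul3 x y g a b c d e f :
  coprod U g = a ⊗ b + c ⊗ d + e ⊗ f ->
  (x * y) ◁ g = (x ◁ a) * (y ◁ b) + (x ◁ c) * (y ◁ d) + (x ◁ e) * (y ◁ f).
Proof.
move=> E; rewrite ltrans_mul (congr1 (mul_ltrans x y) E) 2!mul_ltransD.
by congr (_ + _ + _); apply: mul_ltrans_tens.
Qed.

Lemma pairing_mul1 x y :
  pairing (x * y) (1 : U) = pairing x (1 : U) * pairing y (1 : U).
Proof. by rewrite dual_mulE coprod1 dtensE. Qed.

Lemma dual_coprod0 : dual_coprod (0 : hdual U) = 0.
Proof.
apply/funext=> p; rewrite /dual_coprod.
by have := pairingZl 0 (0 : ldual R I) (basis U p.1 * basis U p.2); rewrite scale0r mul0r.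
Qed.

(** The action on the first tensor factor, slice by slice in the second index. *)
Definition ltrans1st (T : ldual R (I * I)%type) g : ldual R (I * I)%type :=
  fun p => ((fun i => T (i, p.2)) ◁ g) p.1.

Lemma ltrans1stD T T' g : ltrans1st (T + T') g = ltrans1st T g + ltrans1st T' g.
Proof.
apply/funext=> p; rewrite /ltrans1st.
exact: (congr1 (fun y : hdual U => y p.1)
  (ltransDl (fun i => T (i, p.2)) (fun i => T' (i, p.2)) g)).
Qed.

Lemma ltrans1st_dtens x y g : ltrans1st (x ⊗^* y) g = (x ◁ g) ⊗^* y.
Proof.
apply/funext=> p; rewrite /ltrans1st /dtens /=.
rewrite [RHS]mulrC; apply: etrans
  (congr1 (fun z : hdual U => z p.1) (ltransZl (y p.2) x g)).
by congr (ltrans _ g p.1); apply/funext=> i; rewrite [LHS]mulrC.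
Qed.

Lemma ltrans1st_coprod x g : ltrans1st (dual_coprod x) g = dual_coprod (x ◁ g).
Proof.
apply/funext=> p; rewrite /ltrans1st /dual_coprod /= ltransE mulrA.
by rewrite -pairing_mulr.
Qed.

Lemma dual_coprod_basis1 x i j : basis U i = 1 -> dual_coprod x (i, j) = x j.
Proof. by move=> i1; rewrite /dual_coprod /= i1 mul1r pairing_basis. Qed.

Lemma dual_coprod_one : dual_coprod (1 : hdual U) = (1 : hdual U) ⊗^* (1 : hdual U).
Proof. by apply/funext=> p; rewrite /dual_coprod dual1E counitM. Qed.

(** Both sides pair [x ⊗^* y] with Delta(X) Delta(Y), because the coproduct of H is
    multiplicative. *)
Lemma dual_coprodM x y :
  dual_coprod (x * y) = dual_tens_mul U (dual_coprod x) (dual_coprod y).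
Proof.
apply/funext=> p; rewrite /dual_coprod dual_mulE coprodM /tens_mul.
rewrite /pairing lin_comp /dual_tens_mul /pairing.
congr (lin (W := R^o) _ _); apply/funext=> k.
rewrite lin_comp; congr (lin (W := R^o) _ _); apply/funext=> l.
exact: dtensE.
Qed.

End LeftTranslation.

Local Notation "x ◁ g" := (ltrans x g) (at level 39, left associativity).

(** * Action of series in alpha g on functionals of low degree *)

Section AlphaSeries.
Variables (R : fieldType) (I : choiceType) (U : thopf R I).
Implicit Types (x : hdual U) (g : U) (f : nat -> R).

Lemma ltrans_alpha_eval0 x g f :
  x ◁ g = 0 -> x ◁ alpha_eval f g = fpsC (f 0%N) *: x.
Proof.
move=> xg; rewrite alpha_eval_rec ltransDr !ltransZr ltransM xg ltrans0l.
by rewrite scaler0 addr0 ltrans1.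
Qed.

(** The coordinates are all annihilated by the square of [P1], so of each series only the first two
    coefficients act on them. *)
Lemma ltrans_alpha_eval1 x g f : x ◁ g ◁ g = 0 ->
  x ◁ alpha_eval f g = fpsC (f 0%N) *: x + (alpha R * fpsC (f 1%N)) *: (x ◁ g).
Proof.
move=> xgg; rewrite alpha_eval_rec ltransDr !ltransZr ltransM ltrans1.
by rewrite ltrans_alpha_eval0 // scalerA.
Qed.

Lemma alpha_eval_divalphaK f g : f 0%N = 1 ->
  alpha R *: (divalpha (alpha_eval f g - 1) : U) = alpha_eval f g - 1.
Proof.
move=> f0; rewrite alpha_eval_rec f0.
have -> : fpsC 1 *: (1 : U) = 1 by rewrite scale1r.
rewrite [X in divalpha X]addrC addKr addrC addKr.
by apply: divalphaK; rewrite alphaZE.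
Qed.

Lemma ltrans_divalpha x g f : f 0%N = 1 -> x ◁ g ◁ g = 0 ->
  x ◁ (divalpha (alpha_eval f g - 1) : U) = fpsC (f 1%N) *: (x ◁ g).
Proof.
move=> f0 xgg; set D := (divalpha _ : U).
(* The quotient by alpha is never expanded: the identity is checked after multiplication by alpha,
   which is injective. *)
have E : alpha R *: (x ◁ D) = alpha R *: (fpsC (f 1%N) *: (x ◁ g)).
  rewrite -ltransZr alpha_eval_divalphaK // ltransBr ltrans_alpha_eval1 // f0.
  by rewrite ltrans1 scale1r addrAC subrr add0r scalerA.
apply/funext=> i; apply: (@alphaZ_inj R R^o).
by have := congr1 (fun y : hdual U => y i) E.
Qed.

End AlphaSeries.

(** * Action of the generators on values at basis monomials *)

Section Poincare.
Variables (R : numFieldType) (U : thopf R pbw) (M P0 P1 K : U).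
Hypothesis HU : quantum_poincare M P0 P1 K.
Implicit Types (x y : hdual U) (f : nat -> fps R).

Let eP := alpha_eval (exp_coef R) P1.
Let eN := alpha_eval (exp_coef R) (- P1).

Lemma basisE a b c d : basis U (a, b, c, d) = M ^+ a * P0 ^+ b * P1 ^+ c * K ^+ d.
Proof. exact: qp_basis HU _ _ _ _. Qed.

Lemma commutator0_comm (g h : U) : ⟦g, h⟧ = 0 -> GRing.comm g h.
Proof. exact: subr0_eq. Qed.

(** [M] leads the ordered monomials, and [P0] and [P1] commute with everything to the left of their
    own powers, so each raises its own exponent. [K] stands last, and is used this way only on its
    pure powers. *)
Lemma ltransME x a b c d : (x ◁ M) (a, b, c, d) = x (a.+1, b, c, d).
Proof. by rewrite /ltrans basisE !mulrA -exprS -basisE pairing_basis. Qed.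

Lemma ltransP0E x a b c d : (x ◁ P0) (a, b, c, d) = x (a, b.+1, c, d).
Proof.
have cM : P0 * M ^+ a = M ^+ a * P0 :=
  commrX a (commr_sym (commutator0_comm (qp_MP0 HU))).
by rewrite /ltrans basisE !mulrA cM -[_ * P0 * _]mulrA -exprS -basisE pairing_basis.
Qed.

Lemma ltransP1E x a b c d : (x ◁ P1) (a, b, c, d) = x (a, b, c.+1, d).
Proof.
have cM : P1 * M ^+ a = M ^+ a * P1 :=
  commrX a (commr_sym (commutator0_comm (qp_MP1 HU))).
have c0 : P1 * P0 ^+ b = P0 ^+ b * P1 :=
  commrX b (commr_sym (commutator0_comm (qp_P0P1 HU))).
rewrite /ltrans basisE !mulrA cM -[_ * P1 * _]mulrA c0 mulrA -[_ * P1 * _]mulrA.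
by rewrite -exprS -basisE pairing_basis.
Qed.

Lemma mulK_basis d : K * basis U (0, 0, 0, d)%N = basis U (0, 0, 0, d.+1)%N.
Proof. by rewrite !basisE !expr0 !mul1r exprS. Qed.

Lemma ltransKE x d : (x ◁ K) (0, 0, 0, d)%N = x (0, 0, 0, d.+1)%N.
Proof. by rewrite /ltrans mulK_basis pairing_basis. Qed.

(** Every basis monomial that is not a power of [K] is [M], [P0] or [P1] times another basis
    monomial. *)
Lemma hdual_ext x y : x ◁ M = y ◁ M -> x ◁ P0 = y ◁ P0 -> x ◁ P1 = y ◁ P1 ->
  (forall d, x (0, 0, 0, d)%N = y (0, 0, 0, d)%N) -> x = y.
Proof.
move=> eM e0 e1 eK; apply/funext=> -[[[[|a] b] c] d]; last by rewrite -!ltransME eM.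
case: b => [|b]; last by rewrite -!ltransP0E e0.
by case: c => [|c]; last by rewrite -!ltransP1E e1.
Qed.

(** Since K g = g K + [K, g], the left-hand sides are the images of [x ◁ K] under the three
    generators, and [hdual_ext] applies. *)
Lemma ltransK_ext x y :
  x ◁ M ◁ K + x ◁ ⟦K, M⟧ = y ◁ M ->
  x ◁ P0 ◁ K + x ◁ ⟦K, P0⟧ = y ◁ P0 ->
  x ◁ P1 ◁ K + x ◁ ⟦K, P1⟧ = y ◁ P1 ->
  (forall d, x (0, 0, 0, d.+1)%N = y (0, 0, 0, d)%N) -> x ◁ K = y.
Proof.
have comm (g : U) : x ◁ K ◁ g = x ◁ g ◁ K + x ◁ ⟦K, g⟧.
  by rewrite -!ltransM -ltransDr addrC subrK.
by move=> eM e0 e1 eK; apply: hdual_ext => [|||d]; rewrite ?comm ?ltransKE.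
Qed.

Lemma one_basis : 1 = basis U (0, 0, 0, 0)%N.
Proof. by rewrite basisE !expr0 !mulr1. Qed.
Lemma M_basis : M = basis U (1, 0, 0, 0)%N.
Proof. by rewrite basisE !expr0 !mulr1. Qed.
Lemma P0_basis : P0 = basis U (0, 1, 0, 0)%N.
Proof. by rewrite basisE !expr0 !mulr1 mul1r. Qed.
Lemma P1_basis : P1 = basis U (0, 0, 1, 0)%N.
Proof. by rewrite basisE !expr0 !mulr1 !mul1r. Qed.
Lemma K_basis : K = basis U (0, 0, 0, 1)%N.
Proof. by rewrite basisE !expr0 !mul1r. Qed.

(* The functionals in the closed span of the [x_{000d}]. *)
Definition Kfun f : hdual U :=
  fun i => if i is (0, 0, 0, d)%N then f d else 0.

Lemma Kfun_shift f :
  [/\ Kfun f ◁ M = 0, Kfun f ◁ P0 = 0 & Kfun f ◁ P1 = 0].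
Proof.
split; apply/funext=> -[[[a b] c] d].
- by rewrite ltransME.
- by rewrite ltransP0E; case: a.
- by rewrite ltransP1E; case: a b => [|a] [|b].
Qed.

Lemma Kfun_M f : Kfun f ◁ M = 0. Proof. by case: (Kfun_shift f). Qed.
Lemma Kfun_P0 f : Kfun f ◁ P0 = 0. Proof. by case: (Kfun_shift f). Qed.
Lemma Kfun_P1 f : Kfun f ◁ P1 = 0. Proof. by case: (Kfun_shift f). Qed.

Lemma exp_coef0 : exp_coef R 0 = 1. Proof. by rewrite /exp_coef invr1. Qed.
Lemma exp_coef1 : exp_coef R 1 = 1. Proof. by rewrite /exp_coef invr1. Qed.
Lemma cosh_coef0 : cosh_coef R 0 = 1. Proof. by rewrite /cosh_coef invr1. Qed.
Lemma cosh_coef1 : cosh_coef R 1 = 0. Proof. by []. Qed.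

Lemma scale_fpsC1 (V : lmodType (fps R)) (v : V) : fpsC 1 *: v = v.
Proof. exact: scale1r. Qed.

Lemma scale_fpsC0 (V : lmodType (fps R)) (v : V) : fpsC 0 *: v = 0.
Proof.
have -> : fpsC 0 = 0 :> fps R by apply/funext=> -[].
exact: scale0r.
Qed.

Lemma ltrans_eP x : x ◁ P1 ◁ P1 = 0 -> x ◁ eP = x + alpha R *: (x ◁ P1).
Proof.
by move=> h; rewrite ltrans_alpha_eval1 // exp_coef0 exp_coef1 scale_fpsC1 mulr1.
Qed.

Lemma ltrans_eN x : x ◁ P1 ◁ P1 = 0 -> x ◁ eN = x - alpha R *: (x ◁ P1).
Proof.
move=> h; rewrite ltrans_alpha_eval1; last by rewrite !ltransNr ltransNl h !oppr0.
by rewrite exp_coef0 exp_coef1 scale_fpsC1 mulr1 ltransNr scalerN.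
Qed.

Lemma ltransKP0 x : x ◁ P1 ◁ P1 = 0 -> x ◁ ⟦K, P0⟧ = x ◁ P1.
Proof.
by move=> h; rewrite (qp_KP0 HU) ltrans_divalpha ?exp_coef0 // exp_coef1 scale_fpsC1.
Qed.

Lemma ltransKP1 x : x ◁ ⟦K, P1⟧ = (x ◁ M + x ◁ P0) ◁ eP.
Proof. by rewrite (qp_KP1 HU) ltransM ltransDr. Qed.

(** The cosh term vanishes because cosh has no linear coefficient, the other one because
    [(M + P0) ^+ 2] acts before the exponential and already gives 0. *)
Lemma ltransKM x : x ◁ P1 ◁ P1 = 0 -> (x ◁ M + x ◁ P0) ◁ (M + P0) = 0 ->
  x ◁ ⟦K, M⟧ = 0.
Proof.
move=> h h2; rewrite (qp_KM HU) ltransNr ltransDr ltrans_divalpha ?cosh_coef0 //.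
rewrite cosh_coef1 scale_fpsC0 add0r ltransZr !ltransM (ltransDr x) h2.
by rewrite ltrans0l scaler0 oppr0.
Qed.

Lemma Kfun_K f : Kfun f ◁ K = Kfun (fun d => f d.+1).
Proof.
have e : [/\ Kfun f ◁ M = 0, Kfun f ◁ P0 = 0 & Kfun f ◁ P1 = 0] := Kfun_shift f.
case: e => eM e0 e1; apply: ltransK_ext => //.
- by rewrite eM ltrans0l Kfun_M ltransKM ?addr0 // ?e1 ?eM ?e0 ?addr0 ?ltrans0l.
- by rewrite e0 ltrans0l Kfun_P0 ltransKP0 ?e1 ?addr0 ?ltrans0l.
- by rewrite e1 ltrans0l Kfun_P1 ltransKP1 eM e0 addr0 ltrans0l addr0.
Qed.

Lemma Kfun_eP f : Kfun f ◁ eP = Kfun f.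
Proof. by rewrite ltrans_eP Kfun_P1 ?ltrans0l // scaler0 addr0. Qed.

(** * The coordinates and their images under the generators *)

Let theta : hdual U := dbasis R (1, 0, 0, 0)%N.
Let a0 : hdual U := dbasis R (0, 1, 0, 0)%N.
Let a1 : hdual U := dbasis R (0, 0, 1, 0)%N.
Let chi : hdual U := dbasis R (0, 0, 0, 1)%N.
(** As [chi ^+ n] is n! times the vector dual to [K ^+ n], the factorials of the series cancel and
    leave parity indicators. That the series converge to these is [cosh_cvg] and [sinh_cvg]. *)
Definition cosh_chi : hdual U := Kfun (fun d => (~~ odd d)%:R).
Definition sinh_chi : hdual U := Kfun (fun d => (odd d)%:R).

Lemma chiE : chi = Kfun (fun d => (d == 1)%N%:R).
Proof.
apply/funext=> -[[[a b] c] d]; rewrite /chi /dbasis /Kfun !xpair_eqE.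
by case: a b c => [|a] [|b] [|c] //=; rewrite eq_sym.
Qed.

(** The counit is not prescribed on the generators; the counit axiom, paired with the functional [x]
    dual to the unit, forces its values. *)
Lemma counit_gens :
  [/\ counit U M = 0, counit U P0 = 0, counit U P1 = 0 & counit U K = 0].
Proof.
pose x : hdual U := dbasis R (0, 0, 0, 0)%N.
have x1 : pairing x (1 : U) = 1 by rewrite one_basis pairing_basis.
have [xM x0 x2 xK] :
    [/\ pairing x M = 0, pairing x P0 = 0, pairing x P1 = 0 & pairing x K = 0].
  by split; rewrite ?M_basis ?P0_basis ?P1_basis ?K_basis pairing_basis.
split.
- have := counit_suml3 x (qp_coM HU).
  by rewrite x1 xM x0 mulr1 !mulr0 !addr0.
- have := counit_suml x (qp_coP0 HU).
  by rewrite x1 x0 mulr1 !mulr0 !addr0.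
- have := counit_suml x (qp_coP1 HU).
  by rewrite x1 x2 mulr1 !mulr0 !addr0.
(* For [K] the right counit axiom is convenient: the exponential then multiplies the pairing of [x]
   with [K], which is 0. *)
- have := counit_sumr x (qp_coK HU).
  by rewrite x1 xK mul1r !mul0r !add0r.
Qed.

Lemma dual_oneE : 1 = Kfun (fun d => (d == 0)%N%:R).
Proof.
case: counit_gens => cM c0 c1 cK.
have shift (g : U) : counit U g = 0 -> (1 : hdual U) ◁ g = 0.
  by move=> cg; rewrite ltrans_dual1 cg; apply: scale0r.
apply: hdual_ext; rewrite ?Kfun_M ?Kfun_P0 ?Kfun_P1 ?shift //= => -[|d].
  by rewrite -[LHS](pairing_basis (1 : hdual U)) -[ebasis _ _]one_basis dual1E counit1.
by rewrite -ltransKE shift.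
Qed.

Lemma one_M : (1 : hdual U) ◁ M = 0. Proof. by rewrite dual_oneE Kfun_M. Qed.
Lemma one_P0 : (1 : hdual U) ◁ P0 = 0. Proof. by rewrite dual_oneE Kfun_P0. Qed.
Lemma one_P1 : (1 : hdual U) ◁ P1 = 0. Proof. by rewrite dual_oneE Kfun_P1. Qed.
Lemma one_K : (1 : hdual U) ◁ K = 0.
Proof. by rewrite dual_oneE Kfun_K; apply/funext=> -[[[[|a] [|b]] [|c]] d]. Qed.
Lemma one_eP : (1 : hdual U) ◁ eP = 1. Proof. by rewrite dual_oneE Kfun_eP. Qed.

Lemma chi_K : chi ◁ K = 1.
Proof. by rewrite chiE Kfun_K dual_oneE. Qed.

Lemma cosh_K : cosh_chi ◁ K = sinh_chi.
Proof. by rewrite Kfun_K; congr Kfun; apply/funext=> d; rewrite /= negbK. Qed.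

Lemma sinh_K : sinh_chi ◁ K = cosh_chi.
Proof. by rewrite Kfun_K. Qed.

Lemma theta_shift : [/\ theta ◁ M = 1, theta ◁ P0 = 0 & theta ◁ P1 = 0].
Proof.
split; rewrite ?dual_oneE; apply/funext=> -[[[a b] c] d].
- by rewrite ltransME /theta /dbasis /Kfun !xpair_eqE;
    case: a b c d => [|?] [|?] [|?] [|?].
- by rewrite ltransP0E /theta /dbasis !xpair_eqE andbF.
- by rewrite ltransP1E /theta /dbasis !xpair_eqE andbF.
Qed.

Lemma a0_shift : [/\ a0 ◁ M = 0, a0 ◁ P0 = 1 & a0 ◁ P1 = 0].
Proof.
split; rewrite ?dual_oneE; apply/funext=> -[[[a b] c] d].
- by rewrite ltransME.
- by rewrite ltransP0E /a0 /dbasis /Kfun !xpair_eqE;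
    case: a b c d => [|?] [|?] [|?] [|?].
- by rewrite ltransP1E /a0 /dbasis !xpair_eqE andbF.
Qed.

Lemma a1_shift : [/\ a1 ◁ M = 0, a1 ◁ P0 = 0 & a1 ◁ P1 = 1].
Proof.
split; rewrite ?dual_oneE; apply/funext=> -[[[a b] c] d].
- by rewrite ltransME.
- by rewrite ltransP0E /a1 /dbasis !xpair_eqE andbF.
- by rewrite ltransP1E /a1 /dbasis /Kfun !xpair_eqE;
    case: a b c d => [|?] [|?] [|?] [|?].
Qed.

(** The one nonzero image is under [P1]: [K, P1] sends [theta] to [theta ◁ M ◁ eP = 1], which is
    [a1 ◁ P1]. For [a0] the same happens through [a0 ◁ P0], and for [a1] through [K, P0], which acts
    on it as [P1]. *)
Lemma theta_K : theta ◁ K = a1.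
Proof.
case: theta_shift a1_shift => tM t0 t1 [aM a0' a1'].
apply: ltransK_ext => //.
- rewrite tM one_K aM ltransKM ?addr0 // ?t1 ?ltrans0l //.
  by rewrite tM t0 addr0 ltransDr one_M one_P0 addr0.
- by rewrite t0 a0' ltrans0l add0r ltransKP0 ?t1 ?ltrans0l.
- by rewrite t1 ltrans0l add0r ltransKP1 tM t0 addr0 one_eP.
Qed.

Lemma a0_K : a0 ◁ K = a1.
Proof.
case: a0_shift a1_shift => tM t0 t1 [aM a0' a1'].
apply: ltransK_ext => //.
- rewrite tM ltrans0l aM ltransKM ?addr0 // ?t1 ?ltrans0l //.
  by rewrite tM t0 add0r ltransDr one_M one_P0 addr0.
- by rewrite t0 a0' one_K add0r ltransKP0 ?t1 ?ltrans0l.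
- by rewrite t1 ltrans0l add0r ltransKP1 tM t0 add0r one_eP.
Qed.

Lemma a1_K : a1 ◁ K = a0.
Proof.
case: a0_shift a1_shift => tM t0 t1 [aM a0' a1'].
apply: ltransK_ext => //.
- by rewrite aM ltrans0l tM ltransKM ?addr0 // ?a1' ?one_P1 // aM a0' addr0 ltrans0l.
- by rewrite a0' ltrans0l add0r ltransKP0 ?a1' ?one_P1.
- by rewrite a1' one_K add0r ltransKP1 aM a0' addr0 ltrans0l.
Qed.

Lemma ltrans_mul_M x y :
  (x * y) ◁ M = (x ◁ M) * y + (x ◁ eN) * (y ◁ M) + (x ◁ eN - x) * (y ◁ P0).
Proof. by rewrite (ltrans_mul3 x y (qp_coM HU)) ltransBr !ltrans1. Qed.

Lemma ltrans_mul_P0 x y : (x * y) ◁ P0 = (x ◁ P0) * y + x * (y ◁ P0).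
Proof. by rewrite (ltrans_mul2 x y (qp_coP0 HU)) !ltrans1. Qed.

Lemma ltrans_mul_P1 x y : (x * y) ◁ P1 = (x ◁ P1) * y + x * (y ◁ P1).
Proof. by rewrite (ltrans_mul2 x y (qp_coP1 HU)) !ltrans1. Qed.

Lemma ltrans_mul_K x y : (x * y) ◁ K = (x ◁ K) * (y ◁ eP) + x * (y ◁ K).
Proof. by rewrite (ltrans_mul2 x y (qp_coK HU)) !ltrans1. Qed.

Lemma theta_P1 : theta ◁ P1 = 0. Proof. by case: theta_shift. Qed.
Lemma theta_P0 : theta ◁ P0 = 0. Proof. by case: theta_shift. Qed.
Lemma theta_M : theta ◁ M = 1. Proof. by case: theta_shift. Qed.
Lemma a0_M : a0 ◁ M = 0. Proof. by case: a0_shift. Qed.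
Lemma a0_P0 : a0 ◁ P0 = 1. Proof. by case: a0_shift. Qed.
Lemma a0_P1 : a0 ◁ P1 = 0. Proof. by case: a0_shift. Qed.
Lemma a1_M : a1 ◁ M = 0. Proof. by case: a1_shift. Qed.
Lemma a1_P0 : a1 ◁ P0 = 0. Proof. by case: a1_shift. Qed.
Lemma a1_P1 : a1 ◁ P1 = 1. Proof. by case: a1_shift. Qed.
Lemma chi_M : chi ◁ M = 0. Proof. by rewrite chiE Kfun_M. Qed.
Lemma chi_P0 : chi ◁ P0 = 0. Proof. by rewrite chiE Kfun_P0. Qed.
Lemma chi_P1 : chi ◁ P1 = 0. Proof. by rewrite chiE Kfun_P1. Qed.

Lemma ltrans_eP0 x : x ◁ P1 = 0 -> x ◁ eP = x.
Proof. by move=> h; rewrite ltrans_eP h ?ltrans0l // scaler0 addr0. Qed.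

Lemma ltrans_eN0 x : x ◁ P1 = 0 -> x ◁ eN = x.
Proof. by move=> h; rewrite ltrans_eN h ?ltrans0l // scaler0 subr0. Qed.

Lemma theta_eP : theta ◁ eP = theta. Proof. exact: ltrans_eP0 theta_P1. Qed.
Lemma theta_eN : theta ◁ eN = theta. Proof. exact: ltrans_eN0 theta_P1. Qed.
Lemma a0_eP : a0 ◁ eP = a0. Proof. exact: ltrans_eP0 a0_P1. Qed.
Lemma a0_eN : a0 ◁ eN = a0. Proof. exact: ltrans_eN0 a0_P1. Qed.
Lemma chi_eP : chi ◁ eP = chi. Proof. exact: ltrans_eP0 chi_P1. Qed.
Lemma chi_eN : chi ◁ eN = chi. Proof. exact: ltrans_eN0 chi_P1. Qed.
(** Among the coordinates only [a1] is moved by the exponentials; this shift by alpha is the source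
    of all nonzero commutators. *)
Lemma a1_eP : a1 ◁ eP = a1 + alpha R *: (1 : hdual U).
Proof. by rewrite ltrans_eP a1_P1 ?one_P1. Qed.
Lemma a1_eN : a1 ◁ eN = a1 - alpha R *: (1 : hdual U).
Proof. by rewrite ltrans_eN a1_P1 ?one_P1. Qed.

(** * Commutation relations *)

Definition ltrans_genE := (theta_M, theta_P0, theta_P1, theta_K, theta_eP, theta_eN,
  a0_M, a0_P0, a0_P1, a0_K, a0_eP, a0_eN, a1_M, a1_P0, a1_P1, a1_K, a1_eP, a1_eN,
  chi_M, chi_P0, chi_P1, chi_K, chi_eP, chi_eN,
  one_M, one_P0, one_P1, one_K, Kfun_M, Kfun_P0, Kfun_P1, cosh_K, sinh_K).

(** Evaluation at the unit of H is multiplicative with commutative values. This is the base case of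
    the inductions on the exponent of [K]. *)
Lemma comm_at1 x y : ⟦x, y⟧ (0, 0, 0, 0)%N = 0.
Proof.
rewrite -[LHS]pairing_basis -[ebasis _ _]one_basis.
have -> : pairing ⟦x, y⟧ (1 : U) = pairing (x * y) (1 : U) - pairing (y * x) (1 : U).
  by rewrite /commutator pairingDl -scaleN1r pairingZl mulN1r.
by rewrite !pairing_mul1 mulrC subrr.
Qed.

Lemma hdual_at_K x y d : x ◁ K = y -> x (0, 0, 0, d.+1)%N = y (0, 0, 0, d)%N.
Proof. by move=> <-; rewrite ltransKE. Qed.

Lemma zmod_swap3 (V : zmodType) (a b c d : V) : a + b + c - (d + a) = c - d + b.
Proof.
by rewrite opprD addrA addrAC -[a + b + c]addrA [a + _]addrC addrK -addrA addrC.
Qed.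

Lemma zmod_swap2 (V : zmodType) (a c d : V) : a + c - (d + a) = c - d.
Proof. by rewrite opprD addrA addrAC [a + c]addrC addrK. Qed.

Definition zero_simp := (@mulr0, @mul0r, @mulr1, @mul1r, @addr0, @add0r, @subrr, @subr0,
  @scaler0, @oppr0, @ltrans0l).

Lemma comm_a0_a1 : ⟦a0, a1⟧ = alpha R *: theta.
Proof.
apply: hdual_ext.
(* The only surviving term is [(a1 ◁ eN - a1) * (a0 ◁ P0)], equal to minus alpha, from the product
   [a1 * a0]. *)
- rewrite /commutator ltransBl !ltrans_mul_M ltransZl !ltrans_genE !mulr0 !mul0r !mulr1.
  by rewrite !add0r [a1 - _]addrC addrK opprK.
- by rewrite /commutator ltransBl !ltrans_mul_P0 ltransZl !ltrans_genE !zero_simp.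
- by rewrite /commutator ltransBl !ltrans_mul_P1 ltransZl !ltrans_genE !zero_simp.
case=> [|d]; first by rewrite comm_at1 [RHS]mulr0.
(* One application of [K] suffices, since [a1] vanishes on all powers of [K]. *)
have -> : ⟦a0, a1⟧ (0, 0, 0, d.+1)%N = (alpha R *: a1) (0, 0, 0, d)%N.
  apply: hdual_at_K; rewrite /commutator ltransBl !ltrans_mul_K !ltrans_genE mulrDr.
  by rewrite -dual_scaleAr mulr1 zmod_swap3 subrr add0r.
by rewrite [LHS]mulr0 [RHS]mulr0.
Qed.

Lemma comm_theta : ⟦theta, a0⟧ = 0 /\ ⟦theta, a1⟧ = alpha R *: theta.
Proof.
have K0 : ⟦theta, a0⟧ ◁ K = ⟦theta, a1⟧ - alpha R *: theta.
  rewrite /commutator ltransBl !ltrans_mul_K !ltrans_genE -comm_a0_a1 /commutator.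
  by rewrite opprB opprD [a1 * a0 + _]addrC addrACA.
have K1 : ⟦theta, a1⟧ ◁ K = ⟦theta, a0⟧ + alpha R *: a1.
  rewrite /commutator ltransBl !ltrans_mul_K !ltrans_genE mulrDr -dual_scaleAr mulr1.
  by rewrite zmod_swap3.
(* [K] exchanges the two commutators up to multiples of [theta] and [a1], which vanish on powers of
   [K]; hence a joint induction. *)
have H d : ⟦theta, a0⟧ (0, 0, 0, d)%N = 0 /\ ⟦theta, a1⟧ (0, 0, 0, d)%N = 0.
  elim: d => [|d [IH0 IH1]]; first by rewrite !comm_at1.
  rewrite (hdual_at_K d K0) (hdual_at_K d K1) -[LHS]/(_ + - (_ * _)).
  split.
    by rewrite -[LHS]/(⟦theta, a1⟧ (0, 0, 0, d)%N - alpha R * 0) IH1 mulr0 subr0.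
  by rewrite -[LHS]/(⟦theta, a0⟧ (0, 0, 0, d)%N + alpha R * 0) IH0 mulr0 addr0.
split; apply: hdual_ext => [|||d].
- by rewrite /commutator ltransBl !ltrans_mul_M !ltrans_genE !zero_simp.
- by rewrite /commutator ltransBl !ltrans_mul_P0 !ltrans_genE !zero_simp.
- by rewrite /commutator ltransBl !ltrans_mul_P1 !ltrans_genE !zero_simp.
- by case: (H d).
- rewrite /commutator ltransBl !ltrans_mul_M ltransZl !ltrans_genE.
  rewrite !mulr0 mul0r mulr1 mul1r !addr0 add0r.
  by rewrite opprB addrC subrK.
- by rewrite /commutator ltransBl !ltrans_mul_P0 ltransZl !ltrans_genE !zero_simp.
- by rewrite /commutator ltransBl !ltrans_mul_P1 ltransZl !ltrans_genE !zero_simp.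
- by rewrite [RHS]mulr0; case: (H d).
Qed.

Lemma comm_chi : [/\ ⟦chi, theta⟧ = alpha R *: (cosh_chi - 1),
  ⟦chi, a0⟧ = alpha R *: (cosh_chi - 1) & ⟦chi, a1⟧ = alpha R *: sinh_chi].
Proof.
have Kt : ⟦chi, theta⟧ ◁ K = ⟦chi, a1⟧.
  by rewrite /commutator ltransBl !ltrans_mul_K !ltrans_genE mul1r mulr1 zmod_swap2.
have K0 : ⟦chi, a0⟧ ◁ K = ⟦chi, a1⟧.
  by rewrite /commutator ltransBl !ltrans_mul_K !ltrans_genE mul1r mulr1 zmod_swap2.
have K1 : ⟦chi, a1⟧ ◁ K = ⟦chi, a0⟧ + alpha R *: (1 : hdual U).
  by rewrite /commutator ltransBl !ltrans_mul_K !ltrans_genE mul1r mulr1 zmod_swap3.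
(* The extra alpha in [K1] turns cosh - 1 into cosh, so the two values alternate as cosh and sinh do
   under [K]. *)
have H d : ⟦chi, a0⟧ (0, 0, 0, d)%N = (alpha R *: (cosh_chi - 1)) (0, 0, 0, d)%N /\
    ⟦chi, a1⟧ (0, 0, 0, d)%N = (alpha R *: sinh_chi) (0, 0, 0, d)%N.
  rewrite dual_oneE; elim: d => [|d [IH0 IH1]].
    split; rewrite comm_at1; first by rewrite -[RHS]/(alpha R * (1 - 1)) subrr mulr0.
    by rewrite -[RHS]/(alpha R * 0) mulr0.
  rewrite (hdual_at_K d K0) (hdual_at_K d K1) IH1; split.
    by rewrite -[RHS]/(alpha R * ((~~ ~~ odd d)%:R - 0)) negbK subr0.
  rewrite -[LHS]/(_ (0, 0, 0, d)%N + _ (0, 0, 0, d)%N) IH0 dual_oneE -mulrDr.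
  by rewrite subrK.
have cosh1 (g : U) : cosh_chi ◁ g = 0 -> (1 : hdual U) ◁ g = 0 ->
    (alpha R *: (cosh_chi - 1)) ◁ g = 0.
  by move=> cg g1; rewrite ltransZl ltransBl cg g1 subrr scaler0.
have sM := cosh1 M (Kfun_M _) one_M.
have sP0 := cosh1 P0 (Kfun_P0 _) one_P0.
have sP1 := cosh1 P1 (Kfun_P1 _) one_P1.
split; apply: hdual_ext => [|||d]; rewrite ?sM ?sP0 ?sP1.
- by rewrite /commutator ltransBl !ltrans_mul_M !ltrans_genE !zero_simp.
- by rewrite /commutator ltransBl !ltrans_mul_P0 !ltrans_genE !zero_simp.
- by rewrite /commutator ltransBl !ltrans_mul_P1 !ltrans_genE !zero_simp.
(* The commutators of [chi] with [theta] and with [a0] have the same image under [K] and both vanish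
   at the unit, so they agree on powers of [K]. *)
- case: d => [|d]; first by rewrite comm_at1 -(H 0%N).1 comm_at1.
  by rewrite (hdual_at_K d Kt) -(H d.+1).1 (hdual_at_K d K0).
- by rewrite /commutator ltransBl !ltrans_mul_M !ltrans_genE !zero_simp.
- by rewrite /commutator ltransBl !ltrans_mul_P0 !ltrans_genE !zero_simp.
- by rewrite /commutator ltransBl !ltrans_mul_P1 !ltrans_genE !zero_simp.
- by case: (H d).
- by rewrite /commutator ltransBl !ltrans_mul_M ltransZl !ltrans_genE !zero_simp.
- by rewrite /commutator ltransBl !ltrans_mul_P0 ltransZl !ltrans_genE !zero_simp.
- by rewrite /commutator ltransBl !ltrans_mul_P1 ltransZl !ltrans_genE !zero_simp.
- by case: (H d).
Qed.

(** * Coproducts of the coordinates *)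

Lemma ltrans1st_ext (S T : ldual R (pbw * pbw)%type) :
  ltrans1st S M = ltrans1st T M -> ltrans1st S P0 = ltrans1st T P0 ->
  ltrans1st S P1 = ltrans1st T P1 ->
  (forall d j, S ((0, 0, 0, d)%N, j) = T ((0, 0, 0, d)%N, j)) -> S = T.
Proof.
move=> eM e0 e1 eK; apply/funext=> -[i j].
apply: (congr1 (fun x : hdual U => x i) (x := fun k => S (k, j))
  (y := fun k => T (k, j))).
apply: hdual_ext => [|||d] //; apply/funext=> k.
- exact: (congr1 (fun F => F (k, j)) eM).
- exact: (congr1 (fun F => F (k, j)) e0).
- exact: (congr1 (fun F => F (k, j)) e1).
Qed.

Lemma ltrans1st_at_K (S T : ldual R (pbw * pbw)%type) d j :
  ltrans1st S K = T -> S ((0, 0, 0, d.+1)%N, j) = T ((0, 0, 0, d)%N, j).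
Proof. by move=> <-; rewrite /ltrans1st ltransKE. Qed.

Lemma coprod_ext (S T : ldual R (pbw * pbw)%type) :
  ltrans1st S M = ltrans1st T M -> ltrans1st S P0 = ltrans1st T P0 ->
  ltrans1st S P1 = ltrans1st T P1 -> ltrans1st S K = ltrans1st T K ->
  (forall j, S ((0, 0, 0, 0)%N, j) = T ((0, 0, 0, 0)%N, j)) -> S = T.
Proof.
move=> eM e0 e1 eK e; apply: ltrans1st_ext => // -[|d] j //.
by rewrite (ltrans1st_at_K d j eK) (ltrans1st_at_K d j erefl).
Qed.

Lemma dtens0l x : (0 : hdual U) ⊗^* x = 0.
Proof. by apply/funext=> p; rewrite /dtens [LHS]mul0r. Qed.

Lemma dual_coprod_at1 x j : dual_coprod x ((0, 0, 0, 0)%N, j) = x j.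
Proof. by rewrite dual_coprod_basis1 // -one_basis. Qed.

Lemma coprod_chi :
  dual_coprod chi = chi ⊗^* (1 : hdual U) + (1 : hdual U) ⊗^* chi.
Proof.
apply: coprod_ext => [||||j]; rewrite ?ltrans1stD ?ltrans1st_coprod ?ltrans1st_dtens.
- by rewrite !ltrans_genE !dtens0l dual_coprod0 addr0.
- by rewrite !ltrans_genE !dtens0l dual_coprod0 addr0.
- by rewrite !ltrans_genE !dtens0l dual_coprod0 addr0.
- by rewrite !ltrans_genE dtens0l dual_coprod_one addr0.
by rewrite dual_coprod_at1 dual_oneE -[RHS]/(0 * _ + 1 * chi j) mul0r mul1r add0r.
Qed.

Let coprod_a0_rhs :=
  a0 ⊗^* (1 : hdual U) + cosh_chi ⊗^* a0 + sinh_chi ⊗^* a1.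
Let coprod_a1_rhs :=
  a1 ⊗^* (1 : hdual U) + cosh_chi ⊗^* a1 + sinh_chi ⊗^* a0.

(** [K] on the first factor exchanges the two claimed identities, so [coprod_ext] would be circular;
    they are proved together by induction on the exponent of [K]. *)
Lemma coprod_a0_a1 :
  dual_coprod a0 = coprod_a0_rhs /\ dual_coprod a1 = coprod_a1_rhs.
Proof.
have [K0 K1] : ltrans1st coprod_a0_rhs K = coprod_a1_rhs /\
    ltrans1st coprod_a1_rhs K = coprod_a0_rhs.
  split; rewrite !ltrans1stD !ltrans1st_dtens !ltrans_genE.
    by rewrite -addrA [sinh_chi ⊗^* _ + _]addrC addrA.
  by rewrite -addrA [sinh_chi ⊗^* _ + _]addrC addrA.
have H d j : dual_coprod a0 ((0, 0, 0, d)%N, j) = coprod_a0_rhs ((0, 0, 0, d)%N, j) /\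
    dual_coprod a1 ((0, 0, 0, d)%N, j) = coprod_a1_rhs ((0, 0, 0, d)%N, j).
  elim: d => [|d [IH0 IH1]].
    rewrite !dual_coprod_at1; split.
      by rewrite -[RHS]/(0 * _ + 1 * a0 j + 0 * _) !mul0r mul1r add0r addr0.
    by rewrite -[RHS]/(0 * _ + 1 * a1 j + 0 * _) !mul0r mul1r add0r addr0.
  rewrite (ltrans1st_at_K d j K0) (ltrans1st_at_K d j K1).
  rewrite (ltrans1st_at_K d j (ltrans1st_coprod a0 K)).
  by rewrite (ltrans1st_at_K d j (ltrans1st_coprod a1 K)) !ltrans_genE.
split; apply: ltrans1st_ext => [|||d j]; try by case: (H d j).
all: rewrite !ltrans1stD ltrans1st_coprod !ltrans1st_dtens !ltrans_genE !dtens0l.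
all: by rewrite ?dual_coprod0 ?dual_coprod_one !addr0.
Qed.

Lemma coprod_theta : dual_coprod theta =
  theta ⊗^* (1 : hdual U) + (1 : hdual U) ⊗^* theta
  + (cosh_chi - 1) ⊗^* a0 + sinh_chi ⊗^* a1.
Proof.
apply: coprod_ext => [||||j];
  rewrite ?ltrans1stD ?ltrans1st_coprod ?ltrans1st_dtens ?ltransBl.
- by rewrite !ltrans_genE subrr !dtens0l dual_coprod_one !addr0.
- by rewrite !ltrans_genE subrr !dtens0l dual_coprod0 !addr0.
- by rewrite !ltrans_genE subrr !dtens0l dual_coprod0 !addr0.
(* As [theta ◁ K = a1], the condition under [K] is the coproduct of [a1]. *)
- rewrite !ltrans_genE subr0 dtens0l addr0 coprod_a0_a1.2.
  by rewrite /coprod_a1_rhs -addrA [cosh_chi ⊗^* _ + _]addrC addrA.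
rewrite dual_coprod_at1 dual_oneE.
by rewrite -[RHS]/(0 * _ + 1 * theta j + (1 - 1) * a0 j + 0 * _)
  subrr !mul0r mul1r add0r !addr0.
Qed.

(** * Powers of chi and the hyperbolic series *)

Lemma chi_exp n : [/\ (chi ^+ n) ◁ M = 0, (chi ^+ n) ◁ P0 = 0,
  (chi ^+ n) ◁ P1 = 0 & (chi ^+ n) ◁ K = n%:R *: chi ^+ n.-1].
Proof.
(* As the exponential of [P1] fixes [chi], [K] acts on its powers as d/dchi; at n = 0 the truncated
   exponent [n.-1] carries the factor 0. *)
elim: n => [|n [IHM IH0 IH1 IHK]]; first by rewrite expr0 !ltrans_genE scale0r.
rewrite exprSr ltrans_mul_M ltrans_mul_P0 ltrans_mul_P1 ltrans_mul_K.
rewrite IHM IH0 IH1 IHK !ltrans_genE; split.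
- by rewrite !zero_simp.
- by rewrite !zero_simp.
- by rewrite !zero_simp.
rewrite mulr1 -dual_scaleAl; case: n {IHM IH0 IH1 IHK} => [|n].
  by rewrite scale0r add0r scale1r.
by rewrite /= -exprSr -[in RHS]natr1 scalerDl scale1r.
Qed.

Lemma chi_expE n : chi ^+ n = Kfun (fun d => (n == d)%:R * n`!%:R).
Proof.
have [eM e0 e1 _] := chi_exp n.
apply: hdual_ext => [|||d]; rewrite ?Kfun_M ?Kfun_P0 ?Kfun_P1 //.
elim: d n {eM e0 e1} => [|d IH] n.
  case: n => [|n]; first by rewrite expr0 dual_oneE -[RHS]/(1 * 1) mulr1.
  rewrite exprSr -[LHS](pairing_basis (chi ^+ n * chi)) -[ebasis _ _]one_basis.
  rewrite pairing_mul1 [X in _ * pairing chi X]one_basis (pairing_basis chi).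
  by rewrite [LHS]mulr0 -[RHS]/(0 * _) mul0r.
have [_ _ _ eK] := chi_exp n.
rewrite (hdual_at_K d eK); case: n {eK} => [|n].
  by rewrite scale0r -[RHS]/(0 * _) mul0r.
by rewrite -[LHS]/(n.+1%:R * (chi ^+ n) (0, 0, 0, d)%N) IH /= factS natrM mulrCA eqSS.
Qed.

Lemma Kfun_pairing_local (X : tfree R pbw) n : exists N, forall f g,
  (forall d, (d < N)%N -> f d = g d) -> pairing (Kfun f) X n = pairing (Kfun g) X n.
Proof.
(* Coefficient [n] of the pairing involves only [X 0] to [X n], each of finite support; the bound
   exceeds every exponent of [K] occurring there. *)
exists (\max_(p < n.+1) \max_(i <- msupp (X p)) i.2.+1) => f g fg.
rewrite /pairing /lin; apply: eq_bigr => p _; rewrite /vlin.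
apply: eq_big_seq => i iX.
suff -> : Kfun f i = Kfun g i by [].
move: iX; case: i => [[[[|a] [|b]] [|c]] d] //= iX; apply: fg.
apply: leq_trans (leq_bigmax p).
exact: (@leq_bigmax_seq _ _ xpredT (fun i : pbw => i.2.+1) _ iX).
Qed.

Lemma natr_fps k : k%:R = fpsC k%:R :> fps R.
Proof.
elim: k => [|k IH]; first by apply/funext=> -[].
by rewrite -addn1 !natrD IH; apply/funext=> -[|m]; rewrite fpsDE ?addr0.
Qed.

Lemma fpsCM (a b : R) : fpsC a * fpsC b = fpsC (a * b).
Proof.
have := @fpsCZE R R^o a (fpsC b : fps R^o) => E.
by apply/funext=> m; rewrite [LHS]E; case: m => [|m] //=; apply: mulr0.
Qed.

Lemma chi_series_cvg (c : nat -> R) :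
  dseries_cvg (fun n => fpsC (c n) *: chi ^+ n) (Kfun (fun d => fpsC (c d * d`!%:R))).
Proof.
move=> X n; have [N0 H] := Kfun_pairing_local X n; exists N0 => N N0N.
(* A partial sum is the limit functional truncated at exponent [N], so the local bound concludes. *)
have -> : \sum_(k < N) fpsC (c k) *: chi ^+ k =
    Kfun (fun d => if (d < N)%N then fpsC (c d * d`!%:R) else 0).
  elim: N {N0N} => [|N IH].
    by rewrite big_ord0; apply/funext=> -[[[[|a] [|b]] [|x]] d].
  rewrite big_ord_recr /= IH chi_expE; apply/funext=> -[[[[|a] [|b]] [|x]] d];
    rewrite -[LHS]/(_ + _ * _) /= ?mulr0 ?addr0 //.
  rewrite [in RHS]ltnS [in RHS]leq_eqVlt [N == d]eq_sym; case: eqP => [->|_] /=.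
    by rewrite ltnn add0r mul1r natr_fps fpsCM.
  by rewrite mul0r mulr0 addr0.
by apply: H => d dN; rewrite (leq_trans dN).
Qed.

Lemma cosh_cvg : dseries_cvg (fun n => fpsC (cosh_coef R n) *: chi ^+ n) cosh_chi.
Proof.
have -> : cosh_chi = Kfun (fun d => fpsC (cosh_coef R d * d`!%:R)).
  congr Kfun; apply/funext=> d; rewrite /cosh_coef natr_fps; congr fpsC.
  by case: odd; rewrite ?mul0r // mulVf // Num.Theory.pnatr_eq0 -lt0n fact_gt0.
exact: chi_series_cvg.
Qed.

Lemma sinh_cvg : dseries_cvg (fun n => fpsC (sinh_coef R n) *: chi ^+ n) sinh_chi.
Proof.
have -> : sinh_chi = Kfun (fun d => fpsC (sinh_coef R d * d`!%:R)).
  congr Kfun; apply/funext=> d; rewrite /sinh_coef natr_fps; congr fpsC.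
  by case: odd; rewrite ?mul0r // mulVf // Num.Theory.pnatr_eq0 -lt0n fact_gt0.
exact: chi_series_cvg.
Qed.

End Poincare.

Theorem proposition4p4 (R : realType) (U : thopf R pbw) (M P0 P1 K : U)
    (HU : quantum_poincare M P0 P1 K) :
  let theta : hdual U := dbasis R (1, 0, 0, 0)%N in
  let a0 : hdual U := dbasis R (0, 1, 0, 0)%N in
  let a1 : hdual U := dbasis R (0, 0, 1, 0)%N in
  let chi : hdual U := dbasis R (0, 0, 0, 1)%N in
  exists cosh_chi sinh_chi : hdual U,
    [/\ dseries_cvg (fun n => fpsC (cosh_coef R n) *: chi ^+ n) cosh_chi,
        dseries_cvg (fun n => fpsC (sinh_coef R n) *: chi ^+ n) sinh_chi,
        [/\ dual_coprod theta =
              theta ⊗^* (1 : hdual U) + (1 : hdual U) ⊗^* theta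
              + (cosh_chi - 1) ⊗^* a0 + sinh_chi ⊗^* a1,
            dual_coprod a0 =
              a0 ⊗^* (1 : hdual U) + cosh_chi ⊗^* a0 + sinh_chi ⊗^* a1,
            dual_coprod a1 =
              a1 ⊗^* (1 : hdual U) + cosh_chi ⊗^* a1 + sinh_chi ⊗^* a0 &
            dual_coprod chi =
              chi ⊗^* (1 : hdual U) + (1 : hdual U) ⊗^* chi],
        [/\ ⟦a0, a1⟧ = alpha R *: theta,
            ⟦theta, a0⟧ = 0 &
            ⟦theta, a1⟧ = alpha R *: theta] /\
        [/\ ⟦chi, theta⟧ = alpha R *: (cosh_chi - 1),
            ⟦chi, a0⟧ = alpha R *: (cosh_chi - 1) &
            ⟦chi, a1⟧ = alpha R *: sinh_chi] &
        dual_coprod (1 : hdual U) = (1 : hdual U) ⊗^* (1 : hdual U) /\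
        forall x y : hdual U,
          dual_coprod (x * y) =
          dual_tens_mul U (dual_coprod x) (dual_coprod y)].
Proof.
have [coprod_a0 coprod_a1] := coprod_a0_a1 HU.
have [comm_theta_a0 comm_theta_a1] := comm_theta HU.
have [comm_chi_theta comm_chi_a0 comm_chi_a1] := comm_chi HU.
(* By [dseries_cvg_unique] the two convergence clauses determine these witnesses. *)
exists (cosh_chi U), (sinh_chi U); split.
- exact: cosh_cvg HU.
- exact: sinh_cvg HU.
- split=> //; first exact: coprod_theta HU.
  exact: coprod_chi HU.
- by split; split=> //; apply: comm_a0_a1 HU.
- by split; [apply: dual_coprod_one | apply: dual_coprodM].
Qed.
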